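(* In the standing setting described in the context, there exist a continuous strictly increasing profile $R:\mathbb R\to(R_-,R_+)$ and a crossing point $\xi_s\in\mathbb R$ such that: (i) $R(\xi_s)=R_s$ and $R$ restricts to a $C^2$ function on $(-\infty,\xi_s)\cup(\xi_s,\infty)$; (ii) $\dot R^2=Z_-(R)$ on $(-\infty,\xi_s)$ and $\dot R^2=Z_+(R)$ on $(\xi_s,\infty)$; (iii) $R(\xi)\to R_\pm$ and $\dot R(\xi)\to0$ as $\xi\to\pm\infty$; (iv) $R$ satisfies, for every $\varphi\in C_c^\infty(\mathbb R)$, $$\int_{\mathbb R}\alpha\frac{\mathcal S'(R)}{R}\dot R\,\dot\varphi\,d\xi+\int_{\mathbb R}\Big(\frac{\mathcal S(R)}{R}-2\alpha\frac{m^2}{R^4}\dot R^2\Big)\varphi\,d\xi=0;$$ hence, together with monotonicity and the endpoint limits, $R\in\mathcal M$.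
   Context: Standing setting. Fix $\alpha>0$, a physical equation of state $\tilde p:(0,\infty)\times\mathbb R\to\mathbb R$, $(\rho,e)\mapsto\tilde p(\rho,e)$, of class $C^2$, real numbers $c,m,q,k$ with $m\neq0$, and end states $R_\pm>0$, $U_\pm,\mathcal E_\pm\in\mathbb R$. Put $e_\pm=\mathcal E_\pm/R_\pm-\frac12U_\pm^2$ and assume the Rankine–Hugoniot relations $R_\pm(U_\pm-c)=m$, $mU_\pm+\tilde p(R_\pm,e_\pm)=q$, $(\mathcal E_\pm+\tilde p(R_\pm,e_\pm))U_\pm-c\,\mathcal E_\pm=k$. For $R>0$ define $$e(R)=e_0+\frac{A}{R}+\frac{m^2}{2R^2},\quad e_0=\frac{k-qc+\frac m2c^2}{m},\quad A=mc-q,$$ the reduced pressure $p(R)=\tilde p(R,e(R))$, and $\mathcal S(R)=q-mc-\frac{m^2}{R}-p(R)$. (Then $e(R_\pm)=e_\pm$ and $\mathcal S(R_\pm)=0$.) Primes denote $d/dR$, dots denote $d/d\xi$. Assume: (1) $R_-<R_+$; (2) Lax inequalities: $U_--\sqrt{p'(R_-)}>c>U_+-\sqrt{p'(R_+)}$ (with $p'(R_\pm)\ge0$); equivalently $m>0$, $\frac{m^2}{R_-^2}-p'(R_-)>0$ and $\frac{m^2}{R_+^2}-p'(R_+)<0$; (3) $p\in C^2((0,\infty))$, and one of the following convexity criteria holds along $(\rho,e)=(R,e(R))$ for $R\in[R_-,R_+]$: (A) the matrix $\begin{pmatrix}\tilde p_{\rho\rho}+\frac{m^2}{R^4}\tilde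 p_e&\tilde p_{\rho e}-\frac1R\tilde p_e\\ \tilde p_{\rho e}-\frac1R\tilde p_e&\tilde p_{ee}\end{pmatrix}$ is positive semidefinite; or (B) $\tilde p_{\rho\rho}\ge0$, $\tilde p_{ee}\ge0$, $\tilde p_e\ge0$, $\tilde p_{\rho e}\ge\frac1R\tilde p_e$, $e'(R)\ge0$. In particular $p''(R)\ge0$, and this inequality is assumed for all $R>0$; (4) $p''$ is Lipschitz in a neighborhood of $R_s$, where the sonic density $R_s\in(R_-,R_+)$ is the unique zero of $\mathcal S'$ in $(0,\infty)$. The class $\mathcal M$ is the set of nondecreasing functions $R:\mathbb R\to[R_-,R_+]$ (continuous representative) with $R\in W^{1,2}_{\mathrm{loc}}(\mathbb R)$, $R(\xi)\to R_\pm$ as $\xi\to\pm\infty$, satisfying the integral identity in (iv) for every $\varphi\in C_c^\infty(\mathbb R)$. Canonical one-sided solutions. With $P(R)=-\frac2R-\frac{2p''(R)}{\mathcal S'(R)}$ and $Q(R)=\frac2\alpha\frac{\mathcal S(R)}{\mathcal S'(R)}$, $Z_-$ is the unique function in $C^1((R_-,R_s))\cap C^0([R_-,R_s))$ with $Z_-'+PZ_-=Q$ on $(R_-,R_s)$ and $Z_-(R_-)=0$; $Z_+$ is the unique function in $C^1((R_s,R_+))\cap C^0((R_s,R_+])$ with $Z_+'+PZ_+=Q$ on $(R_s,R_+)$ and $Z_+(R_+)=0$. *)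

(* Defs.v *)
From HB Require Import structures.
From mathcomp Require Import all_boot all_order all_algebra.
From mathcomp Require Import all_classical all_reals all_analysis.
Import Order.TTheory GRing.Theory Num.Theory.
Import numFieldNormedType.Exports.

Set Implicit Arguments.
Unset Strict Implicit.
Unset Printing Implicit Defensive.

Local Open Scope classical_set_scope.
Local Open Scope ring_scope.

Section Smoothness.
Context {R : realType}.

(* Meant for open D: the derivatives are two-sided. *)
Definition C_on (n : nat) (D : set R) (f : R -> R) : Prop :=
  (forall k x, (k < n)%N -> D x -> derivable (derive1n k f) x 1) /\
  (forall k x, (k <= n)%N -> D x -> {for x, continuous (derive1n k f)}).

Definition test_function (phi : R -> R) : Prop :=
  (forall n, C_on n setT phi) /\ compact (closure [set x | phi x != 0]).

Definition partial1 (f : R -> R -> R) : R -> R -> R :=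
  fun x y => derive1 (f^~ y) x.
Definition partial2 (f : R -> R -> R) : R -> R -> R :=
  fun x y => derive1 (f x) y.

Definition continuous2_at (f : R -> R -> R) (z : R * R) : Prop :=
  {for z, continuous (fun w : R * R => f w.1 w.2)}.

Definition C1_on2 (D : set (R * R)) (f : R -> R -> R) : Prop :=
  forall z, D z ->
    [/\ derivable (f^~ z.2) z.1 1, derivable (f z.1) z.2 1,
        continuous2_at f z, continuous2_at (partial1 f) z
      & continuous2_at (partial2 f) z].

Definition C2_on2 (D : set (R * R)) (f : R -> R -> R) : Prop :=
  [/\ C1_on2 D f, C1_on2 D (partial1 f) & C1_on2 D (partial2 f)].

Definition possemidef n (M : 'M[R]_n) : Prop :=
  forall v : 'cV[R]_n, 0 <= (v^T *m M *m v) ord0 ord0.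

End Smoothness.

Section Sobolev.
Context {R : realType}.
Notation mu := (@lebesgue_measure R).

Definition L2loc (f : R -> R) : Prop :=
  measurable_fun setT f /\ locally_integrable setT (fun x => f x ^+ 2).

Definition weak_derivative (f g : R -> R) : Prop :=
  forall phi : R -> R, test_function phi ->
    \int[mu]_x (f x * derive1 phi x) = - \int[mu]_x (g x * phi x).

(* f belongs to W^{1,2}_loc, and g represents its weak derivative. *)
Definition W12loc (f g : R -> R) : Prop :=
  [/\ L2loc f, L2loc g & weak_derivative f g].

End Sobolev.

(* The fields Rm, Um, Em are the left end state R_-, U_-, \mathcal E_-, and
   Rp, Up, Ep the right one; sd_ptilde is only meaningful for rho > 0. *)
Record shock_data (R : realType) := ShockData {
  sd_alpha : R;
  sd_ptilde : R -> R -> R;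
  sd_c : R; sd_m : R; sd_q : R; sd_k : R;
  Rm : R; Um : R; Em : R;
  Rp : R; Up : R; Ep : R
}.

Section Setting.
Context {R : realType} (s : shock_data R).
Notation mu := (@lebesgue_measure R).

Local Notation alpha := (sd_alpha s).
Local Notation ptilde := (sd_ptilde s).
Local Notation c := (sd_c s).
Local Notation m := (sd_m s).
Local Notation q := (sd_q s).
Local Notation k := (sd_k s).

Definition specific_energy (rho U E : R) : R := E / rho - U ^+ 2 / 2.

Definition rankine_hugoniot (rho U E : R) : Prop :=
  let p := ptilde rho (specific_energy rho U E) in
  [/\ rho * (U - c) = m, m * U + p = q & (E + p) * U - c * E = k].

Definition e0 : R := (k - q * c + m / 2 * c ^+ 2) / m.
Definition energy (r : R) : R :=
  e0 + (m * c - q) / r + m ^+ 2 / (2 * r ^+ 2).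

Definition pressure (r : R) : R := ptilde r (energy r).

Definition calS (r : R) : R := q - m * c - m ^+ 2 / r - pressure r.

Definition convexA (r : R) : Prop :=
  let e := energy r in
  let pe := partial2 ptilde r e in
  let prr := partial1 (partial1 ptilde) r e in
  let pre := partial2 (partial1 ptilde) r e in
  let pee := partial2 (partial2 ptilde) r e in
  possemidef
    (block_mx (prr + m ^+ 2 / r ^+ 4 * pe)%:M (pre - pe / r)%:M
              (pre - pe / r)%:M               pee%:M : 'M[R]_(1 + 1)).

Definition convexB (r : R) : Prop :=
  let e := energy r in
  let pe := partial2 ptilde r e in
  let prr := partial1 (partial1 ptilde) r e in
  let pre := partial2 (partial1 ptilde) r e in
  let pee := partial2 (partial2 ptilde) r e in
  [/\ 0 <= prr, 0 <= pee, 0 <= pe, pe / r <= pre & 0 <= derive1 energy r].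

Record standing_setting (Rs : R) : Prop := StandingSetting {
  alpha_gt0 : 0 < alpha;
  ptilde_C2 : C2_on2 [set z | 0 < z.1] ptilde;
  m_neq0 : m != 0;
  Rm_gt0 : 0 < Rm s;
  Rp_gt0 : 0 < Rp s;
  RH_minus : rankine_hugoniot (Rm s) (Um s) (Em s);
  RH_plus : rankine_hugoniot (Rp s) (Up s) (Ep s);
  Rm_lt_Rp : Rm s < Rp s;
  dp_Rm_ge0 : 0 <= derive1 pressure (Rm s);
  dp_Rp_ge0 : 0 <= derive1 pressure (Rp s);
  lax_minus : c < Um s - Num.sqrt (derive1 pressure (Rm s));
  lax_plus : Up s - Num.sqrt (derive1 pressure (Rp s)) < c;
  pressure_C2 : C_on 2 [set r | 0 < r] pressure;
  convexity : (forall r, Rm s <= r <= Rp s -> convexA r) \/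
              (forall r, Rm s <= r <= Rp s -> convexB r);
  ddp_ge0 : forall r, 0 < r -> 0 <= derive1n 2 pressure r;
  Rs_between : Rm s < Rs < Rp s;
  Rs_unique_zero : forall r, 0 < r -> (derive1 calS r = 0 <-> r = Rs);
  ddp_lipschitz : exists K : R, exists2 V, nbhs Rs V & K.-lipschitz_V (derive1n 2 pressure)
}.

Definition odeP (r : R) : R := - (2 / r) - 2 * derive1n 2 pressure r / derive1 calS r.
Definition odeQ (r : R) : R := 2 / alpha * (calS r / derive1 calS r).

Definition canonical_minus (Rs : R) (Z : R -> R) : Prop :=
  [/\ C_on 1 `]Rm s, Rs[ Z, {within `[Rm s, Rs[, continuous Z},
      forall r, Rm s < r < Rs -> derive1 Z r + odeP r * Z r = odeQ r
    & Z (Rm s) = 0].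

Definition canonical_plus (Rs : R) (Z : R -> R) : Prop :=
  [/\ C_on 1 `]Rs, Rp s[ Z, {within `]Rs, Rp s], continuous Z},
      forall r, Rs < r < Rp s -> derive1 Z r + odeP r * Z r = odeQ r
    & Z (Rp s) = 0].

(* The integral identity for a profile u with (weak) derivative du.  The
   integrability conditions matter because \int is 0 on functions whose
   extended integral is infinite. *)
Definition integral_identity (u du : R -> R) : Prop :=
  forall phi : R -> R, test_function phi ->
    let flux x := alpha * (derive1 calS (u x) / u x) * du x * derive1 phi x in
    let source x := (calS (u x) / u x -
                     2 * alpha * (m ^+ 2 / u x ^+ 4) * du x ^+ 2) * phi x in
    [/\ mu.-integrable setT (EFin \o flux),
        mu.-integrable setT (EFin \o source)
      & \int[mu]_x flux x + \int[mu]_x source x = 0].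

(* The class \mathcal M; u is its own continuous representative. *)
Definition profile_class (u : R -> R) : Prop :=
  [/\ forall x, Rm s <= u x <= Rp s,
      {homo u : x y / x <= y},
      continuous u,
      u x @[x --> -oo] --> Rm s /\ u x @[x --> +oo] --> Rp s
    & exists2 du, W12loc u du & integral_identity u du].

End Setting.

(* Main.v *)
Require Import Defs.
From HB Require Import structures.
From mathcomp Require Import all_boot all_order all_algebra.
From mathcomp Require Import all_classical all_reals all_analysis.
From mathcomp Require Import measurable_realfun ring lra.
Import Order.TTheory GRing.Theory Num.Theory.
Import numFieldNormedType.Exports.
Local Open Scope classical_set_scope.
Local Open Scope ring_scope.

Set Implicit Arguments.
Unset Strict Implicit.
Unset Printing Implicit Defensive.

(** Write [D = |S'|] and [Y = Z / r^2].  On either side of the sonic point the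
    linear equation for [Z] becomes
      [Y' = A S / D + (2 p'' / D) Y],  with [A = 2 / (alpha r^2)],
    and [G = D^2 Y] satisfies
      [G' = A S D - (2 E / D) G],  with [E = 2 m^2 / r^3].
    The second form gives [Y > 0], a bound [G <= C S^2] (hence
    [Z = O((r - R_-)^2)], so the end states are reached only at infinity), and [G -> 0] at the sonic point because [1 / D] is not integrable
    there.  The first form gives [Y -> +oo] at the sonic point for the same
    reason.  Therefore [1 / sqrt Z], extended by 0, is continuous on the whole
    of (R_-, R_+); the profile is the inverse of its primitive.
    The flux [S'(u) u' / u] is continuous across the crossing since its square
    is [G(u)], and off the crossing its derivative is the source term; that
    relation bounds the integral of [u'^2], so integrating by parts on each side
    gives the weak equation. *)

(** Towards the sonic point [D] decreases at rate [E + p'']. Convexity gives only [p'' >= 0],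
    whereas [E] has a positive lower bound, which is why two forms of the equation are needed. The
    factor [D^2] trades the coefficient [2 p'' / D] for [- 2 E / D]. In the second the [E] term is a
    true damping, comparable to the inverse distance to the sonic point, because [D] is Lipschitz
    and vanishes there. Dividing [Z] by [r^2] removes the [- 2 / r] part of the coefficient [P]. The
    obstacle is that [u'] is unbounded at the crossing: [u' = sqrt Z(u)] cannot be integrated
    through the sonic density, and integrability of [u'] and [u'^2] has to be proved. Both times a
    nonnegative function is recognized as the derivative of a function that stays continuous at the
    crossing, so that its integral is at most an increment. *)

(** * Monotonicity, logarithmic divergence and singular damping on the line *)

Section RealAnalysis.
Context {R : realType}.
Implicit Types (F dF G dG : R -> R) (a b c x : R).

Lemma is_derive_continuous F (l x : R) :
  is_derive x 1 F l -> {for x, continuous F}.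
Proof. by case=> dF _; exact/differentiable_continuous/derivable1_diffP. Qed.

Lemma near_neq (x s : R) : x != s -> \forall y \near x, y != s.
Proof. by move=> xs; apply: open_nbhs_nbhs; split=> //; exact: open_neq. Qed.

Lemma is_derive_within_cc F dF a b :
  (forall x, a <= x <= b -> is_derive x 1 F (dF x)) ->
  {within `[a, b], continuous F}.
Proof.
move=> dFab; apply: derivable_within_continuous => x; rewrite in_itv/= => xab.
by case: (dFab x xab).
Qed.

Lemma is_derive_ge0_le F dF a b : a <= b ->
  (forall x, a < x < b -> is_derive x 1 F (dF x)) ->
  {within `[a, b], continuous F} ->
  (forall x, a < x < b -> 0 <= dF x) -> F a <= F b.
Proof.
rewrite le_eqVlt => /predU1P[-> //|ab] dFab cF dF0.
have dF' x : x \in `]a, b[%R -> is_derive x 1 F (dF x).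
  by rewrite in_itv/=; exact: dFab.
have [x xab FE] := MVT ab dF' cF.
rewrite -subr_ge0 FE mulr_ge0 ?subr_ge0 ?(ltW ab)// dF0//.
Qed.

Lemma is_derive_reflect F (l x : R) :
  is_derive (- x) 1 F l -> is_derive x 1 (fun y => F (- y)) (- l).
Proof.
move=> dF; have dN : is_derive x 1 (-%R : R -> R) (- 1).
  exact: is_deriveN (is_derive_id x 1).
by have := is_derive1_comp dF dN; rewrite mulrN1.
Qed.

(** Since [F x - c * ln (x - a)] is nondecreasing, [F x] is at most [c * ln (x - a)] plus a constant
    to the left of the midpoint [x0]. *)
Lemma log_divergence_right F dF a b c : 0 < c -> a < b ->
  (forall x, a < x < b -> is_derive x 1 F (dF x)) ->
  (forall x, a < x < b -> c / (x - a) <= dF x) ->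
  F x @[x --> a^'+] --> -oo.
Proof.
move=> c0 ab dFab dFc.
pose x0 := (a + b) / 2.
have ax0 : a < x0 by rewrite /x0; lra.
have x0b : x0 < b by rewrite /x0; lra.
pose G x := F x - c * ln (x - a).
have dG x : a < x < b -> is_derive x 1 G (dF x - c / (x - a)).
  move=> xab; have xa0 : 0 < x - a by lra.
  have := dFab x xab => dFx.
  have := @is_derive1_ln R (x - a) xa0 => dln.
  have dl : is_derive x 1 (fun y => ln (y - a)) ((x - a)^-1 * 1).
    apply: (@is_derive1_comp _ (@ln R) (fun y => y - a)).
    apply: is_derive_eq; by rewrite subr0.
  rewrite /G; apply: is_derive_eq.
  by rewrite mulr1.
apply/cvgrNyPle => M.
near=> x.
have ax : a < x by near: x; exact: nbhs_right_gt.
have xx0 : x <= x0 by near: x; exact: nbhs_right_ltW.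
have : G x <= G x0.
  apply: (@is_derive_ge0_le G (fun x => dF x - c / (x - a))) => //.
  - by move=> y yx; apply: dG; lra.
  - by apply: (@is_derive_within_cc _ (fun x => dF x - c / (x - a))) => y yx; apply: dG; lra.
  - by move=> y yx; rewrite subr_ge0; apply: dFc; lra.
suff : ln (x - a) <= (M - G x0) / c.
  rewrite ler_pdivlMr// /G; nra.
rewrite -[leRHS]expRK ler_ln ?posrE ?subr_gt0 ?expR_gt0//.
apply/ltW; near: x; apply: nbhs_right_ltDr; exact: expR_gt0.
Unshelve. all: by end_near. Qed.

Lemma log_divergence_left F dF a b c : 0 < c -> a < b ->
  (forall x, a < x < b -> is_derive x 1 F (dF x)) ->
  (forall x, a < x < b -> c / (b - x) <= dF x) ->
  F x @[x --> b^'-] --> +oo.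
Proof.
move=> c0 ab dFab dFc; rewrite -(opprK b) at_leftN -fmap_comp.
have : (fun x => - F (- x)) x @[x --> (- b)^'+] --> -oo.
  apply: (@log_divergence_right _ (fun x => dF (- x)) (- b) (- a) c) => //.
  - by rewrite ltrN2.
  - move=> x xab; rewrite -[dF _]opprK; apply: is_deriveN.
    apply: is_derive_reflect; apply: dFab; lra.
  - move=> x xab; rewrite opprK addrC.
    by have := dFc (- x); rewrite opprK; apply; lra.
by move/cvgNrNy.
Qed.

(* The singular coefficient forces the decay: if [G] stayed above some [e > 0]
   then [G' <= C - k e / (b - x)] would drive it to minus infinity. *)
Lemma singular_decay_left G dG a b (C k : R) : 0 < k -> a < b ->
  (forall x, a < x < b -> is_derive x 1 G (dG x)) ->
  (forall x, a < x < b -> 0 <= G x) ->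
  (forall x, a < x < b -> dG x <= C - k * G x / (b - x)) ->
  G x @[x --> b^'-] --> 0.
Proof.
move=> k0 ab dGab G0 dGC.
(* Enlarging [C] only weakens the bound on [dG]; positivity allows division by [C]. *)
wlog C0 : C dGC / 0 < C.
  move=> H; apply: (H (`|C| + 1)) => [x xab|].
    have := dGC x xab; have := ler_norm C; lra.
  have := normr_ge0 C; lra.
(* The singular term is nonpositive because [G >= 0], so [G] grows at rate at most [C]. *)
have Gdecr x y : a < x -> x <= y -> y < b -> G y <= G x + C * (y - x).
  move=> ax xy yb.
  have H z : a < z < b -> is_derive z 1 (fun t => C * t - G t) (C - dG z).
    move=> zab; have := dGab z zab => dGz; apply: is_derive_eq.
    by rewrite [_ *: _]mulr1.
  suff : C * x - G x <= C * y - G y by lra.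
  apply: (@is_derive_ge0_le (fun t => C * t - G t) (fun t => C - dG t)) => //.
  - by move=> z zxy; apply: H; lra.
  - by apply: (@is_derive_within_cc _ (fun x => C - dG x)) => z zxy; apply: H; lra.
  - move=> z zxy; have zab : a < z < b by lra.
    have := dGC z zab; have : 0 <= k * G z / (b - z).
      by rewrite divr_ge0 ?mulr_ge0 ?G0 ?(ltW k0)//; lra.
    lra.
apply/cvgrPdist_le => e e0.
have [//|Hne] := pselect (\forall x \near b^'-, `|0 - G x| <= e).
exfalso.
(* On the last stretch of length [e / (2 * C)] the function [G] can gain at most [e / 2]. If it were
   below [e / 2] once there, it would stay below [e] up to [b], against [Hne]. *)
pose a' := Num.max a (b - e / (2 * C)).
have a'b : a' < b.
  by rewrite /a' gt_max ab /= ltrBlDr ltrDl divr_gt0// mulr_gt0.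
have aa' : a <= a' by rewrite /a' le_max lexx.
have eC : b - e / (2 * C) <= a' by rewrite /a' le_max lexx orbT.
have Ge x : a' < x < b -> e / 2 <= G x.
  move=> /andP[a'x xb]; rewrite leNgt; apply/negP => Gx; apply: Hne.
  near=> y.
  have xy : x <= y by apply/ltW; near: y; exact: nbhs_left_gt.
  have yb : y < b by near: y; exact: nbhs_left_lt.
  have ay : a < y by lra.
  rewrite sub0r normrN ger0_norm ?G0 ?ay//.
  have := @Gdecr x y; have : C * (y - x) <= C * (e / (2 * C)).
    by rewrite ler_pM2l//; lra.
  have -> : C * (e / (2 * C)) = e / 2 by field; lra.
  have : a < x by lra.
  move=> ax h1 /(_ ax xy yb); lra.
(* With [G >= e / 2] the derivative [C - dG] dominates [(k * (e / 2)) / (b - x)]. The resulting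
   divergence contradicts [C * x - G x <= C * b]. *)
have : (fun x => C * x - G x) x @[x --> b^'-] --> +oo.
  apply: (@log_divergence_left _ (fun x => C - dG x) a' b (k * (e / 2))) => //.
  - by rewrite mulr_gt0// divr_gt0.
  - move=> z zab; have := dGab z => dGz.
    have {}dGz : is_derive z 1 G (dG z) by apply: dGz; lra.
    apply: is_derive_eq.
    by rewrite [_ *: _]mulr1.
  - move=> x xab; have xab' : a < x < b by lra.
    have := dGC x xab'.
    have : k * (e / 2) / (b - x) <= k * G x / (b - x).
      by rewrite ler_pM2r ?invr_gt0 ?ler_pM2l ?Ge//; lra.
    lra.
move=> /cvgryPgt /(_ (C * b)) => H.
near b^'- => x.
have xb : x < b by near: x; exact: nbhs_left_lt.
have ax : a < x by near: x; exact: nbhs_left_gt.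
have : C * b < C * x - G x by near: x.
have : 0 <= G x by apply: G0; lra.
have : C * x < C * b by rewrite ltr_pM2l.
lra.
Unshelve. all: by end_near. Qed.

End RealAnalysis.

(** * The linear equation between an end state [a] and the sonic point [b] *)

Section SonicApproach.
Context {R : realType}.
(** For the left branch [pi] stands for [p''] and [D] for [S']. The constant [e] is the damping
    strength, [L] a Lipschitz constant for [D]. *)
Variables (a b e L A0 A1 : R) (Y S D E pi A : R -> R).
Hypothesis ab : a < b.
Hypothesis e_gt0 : 0 < e.
Hypothesis A0_gt0 : 0 < A0.
Hypothesis dS : forall x, a <= x <= b -> is_derive x 1 S (D x).
Hypothesis dD : forall x, a <= x <= b -> is_derive x 1 D (- (E x + pi x)).
Hypothesis E_ge : forall x, a <= x <= b -> e <= E x.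
Hypothesis pi_ge0 : forall x, a <= x <= b -> 0 <= pi x.
Hypothesis Epi_le : forall x, a <= x <= b -> E x + pi x <= L.
Hypothesis A_bounds : forall x, a <= x <= b -> A0 <= A x <= A1.
Hypothesis Db : D b = 0.
Hypothesis Sa : S a = 0.
Hypothesis dY : forall x, a < x < b ->
  is_derive x 1 Y (A x * S x / D x + 2 * pi x / D x * Y x).
Hypothesis Ya : Y a = 0.
Hypothesis cY : Y x @[x --> a^'+] --> 0.

Let A_gt0 x : a <= x <= b -> 0 < A x.
Proof. by move/A_bounds => /andP[+ _]; exact: lt_le_trans. Qed.

Let E_ge0 x : a <= x <= b -> 0 <= E x.
Proof. by move/E_ge; apply: le_trans; exact: ltW. Qed.

Let cS : {within `[a, b], continuous S}.
Proof. exact: is_derive_within_cc dS. Qed.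

Let within_sub f x y : a <= x -> y <= b -> {within `[a, b], continuous f} ->
  {within `[x, y], continuous (f : R -> R)}.
Proof.
move=> ax yb; apply: continuous_subspaceW; apply: subset_itv; by rewrite bnd_simp.
Qed.

(** [D + L x] is nondecreasing and [D b = 0]. This is what makes [1 / D] non-integrable at [b]. *)
Let D_le x : a <= x <= b -> D x <= L * (b - x).
Proof.
move=> xab; suff : D x + L * x <= D b + L * b by rewrite Db; lra.
have H y : a <= y <= b ->
    is_derive y 1 (fun t => D t + L * t) (- (E y + pi y) + L).
  move=> yab; have := dD yab => dDy.
  by apply: is_derive_eq; rewrite [_ *: _]mulr1.
apply: (@is_derive_ge0_le _ (fun t => D t + L * t) (fun t => - (E t + pi t) + L)).
- lra.
- by move=> y yx; apply: H; lra.
- by apply: (@is_derive_within_cc _ _ (fun t => - (E t + pi t) + L)) => y yx; apply: H; lra.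
- by move=> y yx; have := @Epi_le y; rewrite -subr_ge0; lra.
Qed.

Let D_ge x y : a <= x -> x <= y -> y <= b -> D y + e * (y - x) <= D x.
Proof.
move=> ax xy yb; suff : - (D x + e * x) <= - (D y + e * y) by lra.
have H z : a <= z <= b ->
    is_derive z 1 (fun t => - (D t + e * t)) (- (- (E z + pi z) + e)).
  move=> zab; have := dD zab => dDz.
  by apply: is_derive_eq; rewrite [_ *: _]mulr1.
apply: (@is_derive_ge0_le _ (fun t => - (D t + e * t)) (fun t => - (- (E t + pi t) + e))) => //.
- by move=> z zx; apply: H; lra.
- by apply: (@is_derive_within_cc _ _ (fun t => - (- (E t + pi t) + e))) => z zx; apply: H; lra.
- move=> z zx; have zab : a <= z <= b by lra.
  have := E_ge zab; have := pi_ge0 zab; lra.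
Qed.

Let D_gt0 x : a <= x < b -> 0 < D x.
Proof.
move=> /andP[ax xb]; have := D_ge ax (ltW xb) (lexx b); rewrite Db.
suff : 0 < e * (b - x) by lra.
by rewrite mulr_gt0// subr_gt0.
Qed.

(** Mean value theorem for [S], whose derivative [D] is decreasing. *)
Let S_bounds x y : a <= x -> x <= y -> y <= b ->
  D y * (y - x) <= S y - S x <= D x * (y - x).
Proof.
rewrite le_eqVlt => + + yb.
move=> /predU1P ax; rewrite le_eqVlt => /predU1P[->|xy].
  by rewrite !subrr !mulr0 lexx.
have {}ax : a <= x by case: ax => [->|/ltW].
have H z : z \in `]x, y[%R -> is_derive z 1 S (D z).
  by rewrite in_itv/= => zxy; apply: dS; lra.
have [z zxy ->] := MVT xy H (within_sub ax yb cS).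
move: zxy; rewrite in_itv/= => zxy.
rewrite !ler_pM2r ?subr_gt0//.
have := @D_ge x z; have := @D_ge z y.
have : 0 <= e * (y - z) by rewrite mulr_ge0 ?(ltW e_gt0)//; lra.
have : 0 <= e * (z - x) by rewrite mulr_ge0 ?(ltW e_gt0)//; lra.
have az : a <= z by lra.
have zb : z <= b by lra.
have zy : z <= y by lra.
have xz : x <= z by lra.
move=> h1 h2 /(_ az zy yb) h3 /(_ ax xz zb) h4; lra.
Qed.

Let S_gt0 x : a < x < b -> 0 < S x.
Proof.
move=> xab; have := @S_bounds a x (lexx a); rewrite Sa.
have : 0 < D x * (x - a) by rewrite mulr_gt0 ?D_gt0//; lra.
have ax : a <= x by lra.
have xb : x <= b by lra.
by move=> h /(_ ax xb) => /andP[]; lra.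
Qed.

Let S_le x y : a <= x -> x <= y -> y <= b -> S x <= S y.
Proof.
move=> ax xy yb; have /andP[+ _] := S_bounds ax xy yb.
suff : 0 <= D y * (y - x) by lra.
rewrite mulr_ge0 ?subr_ge0//.
move: yb; rewrite le_eqVlt => /predU1P[->|yb]; first by rewrite Db.
by rewrite ltW// D_gt0// yb (le_trans ax).
Qed.

Let G x := D x ^+ 2 * Y x.

(** Differentiating [D ^+ 2] contributes [- 2 (E + pi) / D * G], whose [pi] part cancels the
    coefficient [2 pi / D] in [dY]. *)
Let dG x : a < x < b ->
  is_derive x 1 G (A x * S x * D x - 2 * E x / D x * G x).
Proof.
move=> xab; have xab' : a <= x <= b by lra.
have Dx : D x != 0 by rewrite gt_eqF// D_gt0//; lra.
have := dD xab' => dDx; have := dY xab => dYx.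
rewrite /G; apply: is_derive_eq.
rewrite /GRing.scale/=; by field.
Qed.

Let cG x : a < x < b -> {within `[a, x], continuous G}.
Proof.
move=> xab; apply/continuous_within_itvP; first lra.
have Gc y : a < y < b -> {for y, continuous G}.
  by move=> /dG; exact: is_derive_continuous.
split.
- by move=> y; rewrite in_itv/= => yx; apply: Gc; lra.
- rewrite /G Ya; apply: cvgM => //.
  apply: cvgM => //.
    apply: cvg_at_right_filter; apply: (is_derive_continuous (dD _)).
    by rewrite lexx ltW.
  apply: cvg_at_right_filter; apply: (is_derive_continuous (dD _)).
  by rewrite lexx ltW.
- by apply: cvg_at_left_filter; apply: Gc.
Qed.

Let Ga : G a = 0.
Proof. by rewrite /G Ya mulr0. Qed.

(* At a point where [G <= 0] the equation gives [G' > 0], which is impossible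
   at the minimum of [G] on an initial segment. *)
Lemma sonic_gt0 x : a < x < b -> 0 < Y x.
Proof.
move=> xab; have xab' : a <= x < b by lra.
suff : 0 < G x by rewrite /G pmulr_rgt0// exprn_gt0// D_gt0.
rewrite ltNge; apply/negP => Gx.
have [c] := EVT_min (ltW (proj1 (andP xab))) (cG xab).
rewrite in_itv/= => cax Gc.
(* The minimum can be taken away from [a]: if it is attained at [a], then [G x <= 0 = G a] makes [x]
   a minimum as well. *)
have [y /andP[ay yx] Gy] : exists2 y, a < y <= x &
    forall t, a <= t <= x -> G y <= G t.
  have Gc' t : a <= t <= x -> G c <= G t by move=> tax; apply: Gc; rewrite in_itv.
  have [ca|ac] := leP c a; last by exists c => //; lra.
  have cE : c = a by lra.
  exists x => [|t /Gc']; first lra.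
  by rewrite cE Ga; apply: le_trans.
have Gy0 : G y <= 0 by rewrite -Ga Gy// lexx/= (le_trans (ltW ay)).
have yab : a < y < b by lra.
have yab' : a <= y < b by lra.
have yab'' : a <= y <= b by lra.
have dG0 : 0 < A y * S y * D y - 2 * E y / D y * G y.
  have : 0 < A y * S y * D y.
    rewrite !mulr_gt0 ?S_gt0 ?D_gt0//.
    exact: A_gt0.
  suff : 2 * E y / D y * G y <= 0 by lra.
  by rewrite mulr_ge0_le0// divr_ge0 ?(ltW (D_gt0 _))// mulr_ge0// E_ge0.
have [/cvg_ex[/= l Hl] dGE] := dG yab.
have lE : l = A y * S y * D y - 2 * E y / D y * G y.
  by rewrite -dGE; apply/esym/cvg_lim.
(* The minimum [y] may be the right end [x], so only difference quotients from the left have a known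
   sign. *)
have : l <= 0.
  have Hl' : h^-1 *: (G (h *: 1 + y) - G y) @[h --> 0^'-] --> l.
    exact: cvg_dnbhs_at_left.
  apply: (cvgr_to_le Hl').
  near=> h.
  have h0 : h < 0 by near: h; exact: nbhs_left_lt.
  have hay : a - y < h by near: h; apply: nbhs_left_gt; lra.
  rewrite /GRing.scale/= mulr1 nmulr_rle0 ?invr_lt0// subr_ge0 Gy//.
  by rewrite -lerBlDr ltW//= (le_trans _ yx)// gerDr ltW.
by rewrite lE leNgt dG0.
Unshelve. all: by end_near. Qed.

Let G_ge0 x : a < x < b -> 0 <= G x.
Proof. by move=> xab; rewrite /G mulr_ge0 ?sqr_ge0// ltW// sonic_gt0. Qed.

(** As [D = S'], the forcing [A S D] is at most the derivative of [A1 / 2 * S ^+ 2], and the damping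
    only lowers [G]; both sides vanish at [a]. *)
Lemma sonic_dominated x : a < x < b -> D x ^+ 2 * Y x <= A1 / 2 * S x ^+ 2.
Proof.
move=> xab; rewrite -/(G x).
suff : A1 / 2 * S a ^+ 2 - G a <= A1 / 2 * S x ^+ 2 - G x.
  by rewrite Sa Ga expr0n/= mulr0; lra.
pose dH t := A1 * S t * D t - (A t * S t * D t - 2 * E t / D t * G t).
apply: (@is_derive_ge0_le _ (fun t => A1 / 2 * S t ^+ 2 - G t) dH); first lra.
- move=> y yax; have yab : a < y < b by lra.
  have yab' : a <= y <= b by lra.
  have := dG yab => dGy; have := dS yab' => dSy.
  rewrite /dH; apply: is_derive_eq.
  rewrite /GRing.scale/=; lra.
- have cGx := cG xab.
  have cSx : {within `[a, x], continuous S} by apply: within_sub => //; lra.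
  move=> y; apply: cvgB; last exact: cGx.
  apply: cvgM; first exact: cvg_cst.
  by apply: cvgM; exact: cSx.
- move=> y yax; have yab : a < y < b by lra.
  have yab' : a <= y <= b by lra.
  have yab'' : a <= y < b by lra.
  have := G_ge0 yab; have := S_gt0 yab; have := D_gt0 yab''.
  have /andP[_ A1y] := A_bounds yab'; have := E_ge yab' => Ey.
  move=> Dy Sy Gy; rewrite /dH.
  have : A y * (S y * D y) <= A1 * (S y * D y).
    by rewrite ler_wpM2r// mulr_ge0// ltW.
  have : 0 <= 2 * E y / D y * G y.
    by rewrite mulr_ge0// divr_ge0 ?(ltW Dy)// mulr_ge0// E_ge0.
  lra.
Qed.

(** Up to the midpoint [D] stays above [D mid], and [S x <= D a * (x - a)]; inserting both in
    [sonic_dominated] gives the constant. A quadratic bound on [Y] means a linear bound on the speed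
    [sqrt Z], so the end state is not reached in finite time. *)
Lemma sonic_le_near_end : exists2 C, 0 < C &
  forall x, a < x <= (a + b) / 2 -> Y x <= (C * (x - a)) ^+ 2.
Proof.
pose mid := (a + b) / 2.
have ab' := ab.
have midab : a <= mid < b by rewrite /mid; lra.
have Dm := D_gt0 midab.
have Da : 0 < D a by apply: D_gt0; rewrite lexx ab.
have A1_gt0 : 0 < A1.
  have aab : a <= a <= b by lra.
  by have := A_bounds aab; have := A_gt0 aab; lra.
exists (Num.sqrt (A1 / 2) * D a / D mid).
  by rewrite divr_gt0// mulr_gt0// sqrtr_gt0 divr_gt0.
move=> x xam; have xab : a < x < b by move: xam midab; rewrite /mid; lra.
have := sonic_dominated xab.
have Dx : D mid <= D x.
  have := @D_ge x mid; have : 0 <= e * (mid - x).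
    by rewrite mulr_ge0 ?(ltW e_gt0)// /mid; lra.
  have ax : a <= x by lra.
  have xm : x <= mid by rewrite /mid; lra.
  have mb : mid <= b by lra.
  by move=> h /(_ ax xm mb); lra.
have Sx : S x <= D a * (x - a).
  have := @S_bounds a x (lexx a); rewrite Sa.
  have ax : a <= x by lra.
  have xb : x <= b by lra.
  by move=> /(_ ax xb); lra.
have Yx := sonic_gt0 xab.
have Sx0 := S_gt0 xab.
move=> H.
have H1 : D mid ^+ 2 * Y x <= A1 / 2 * (D a * (x - a)) ^+ 2.
  apply: (le_trans (le_trans _ H)).
    by rewrite ler_wpM2r ?(ltW Yx)// ler_sqr ?nnegrE ?(ltW Dm)// (le_trans (ltW Dm)).
  rewrite ler_wpM2l ?divr_ge0 ?(ltW A1_gt0)// ler_sqr ?nnegrE ?(ltW Sx0)//.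
  exact: le_trans (ltW Sx0) Sx.
rewrite !exprMn exprVn sqr_sqrtr ?divr_ge0 ?(ltW A1_gt0)//.
have -> : A1 / 2 * D a ^+ 2 / D mid ^+ 2 * (x - a) ^+ 2 =
    (A1 / 2 * (D a * (x - a)) ^+ 2) / D mid ^+ 2.
  by rewrite exprMn; field; rewrite gt_eqF.
by rewrite ler_pdivlMr ?exprn_gt0// mulrC.
Qed.

(** The [pi] term is nonnegative and is dropped; past the midpoint the forcing [A S / D] is at least
    [A0 * S mid / (L * (b - x))]. *)
Lemma sonic_pinfty : Y x @[x --> b^'-] --> +oo.
Proof.
pose mid := (a + b) / 2.
have ab' := ab.
have midab : a < mid < b by rewrite /mid; lra.
have midab' : a <= mid < b by lra.
have L0 : 0 < L.
  have aab : a <= a <= b by lra.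
  by have := Epi_le aab; have := E_ge aab; have := e_gt0; have := pi_ge0 aab; lra.
pose dY' x := A x * S x / D x + 2 * pi x / D x * Y x.
apply: (@log_divergence_left _ Y dY' mid b (A0 * S mid / L)).
- by rewrite divr_gt0// mulr_gt0// S_gt0.
- by lra.
- by move=> x xm; apply: dY; lra.
- move=> x xm; have xab : a < x < b by lra.
  have xab' : a <= x < b by lra.
  have xab'' : a <= x <= b by lra.
  have Dx := D_gt0 xab'.
  rewrite /dY'; have : 0 <= 2 * pi x / D x * Y x.
    rewrite mulr_ge0 ?(ltW (sonic_gt0 _))// divr_ge0 ?(ltW Dx)// mulr_ge0//.
    exact: pi_ge0.
  suff : A0 * S mid / L / (b - x) <= A x * S x / D x by lra.
  rewrite -mulrA -invfM.
  have Sm := S_gt0 midab.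
  apply: ler_pM.
  + by rewrite mulr_ge0// ltW.
  + by rewrite invr_ge0 mulr_ge0 ?(ltW L0)//; lra.
  + apply: ler_pM; [exact: ltW|exact: ltW| by have := A_bounds xab''; lra|].
    by apply: S_le; lra.
  + rewrite lef_pV2 ?posrE// ?D_le// mulr_gt0//; lra.
Qed.

(** The forcing is at most [A1 * S b * D a], and [E >= e], [D <= L * (b - x)] give damping of
    strength [2 * e / L]. *)
Lemma sonic_flux_cvg0 : (D x ^+ 2 * Y x) @[x --> b^'-] --> 0.
Proof.
have aab : a <= a <= b by rewrite lexx ltW.
have L0 : 0 < L.
  by have := Epi_le aab; have := E_ge aab; have := e_gt0; have := pi_ge0 aab; lra.
pose dG' x := A x * S x * D x - 2 * E x / D x * G x.
apply: (@singular_decay_left _ G dG' a b (A1 * S b * D a) (2 * e / L)) => //.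
- by rewrite divr_gt0// mulr_gt0.
- move=> x xab; have xab' : a <= x < b by lra.
  have xab'' : a <= x <= b by lra.
  have Dx := D_gt0 xab'; have Sx := S_gt0 xab.
  rewrite /dG'.
  have : A x * S x * D x <= A1 * S b * D a.
    have A0x : 0 <= A x by rewrite ltW // A_gt0.
    apply: ler_pM; [by rewrite mulr_ge0// ltW|exact: ltW| |].
      apply: ler_pM => //; [exact: ltW|by have := A_bounds xab''; lra|].
      by apply: S_le; lra.
    have := @D_ge a x (lexx a); have : 0 <= e * (x - a).
      by rewrite mulr_ge0 ?(ltW e_gt0)//; lra.
    have ax : a <= x by lra.
    have xb : x <= b by lra.
    by move=> h /(_ ax xb); lra.
  suff : 2 * e / L * G x / (b - x) <= 2 * E x / D x * G x by lra.
  rewrite mulrAC -[X in X * G x <= _]mulrA -invfM.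
  rewrite ler_wpM2r ?G_ge0//.
  apply: ler_pM.
  + by rewrite mulr_ge0// ltW.
  + by rewrite invr_ge0 mulr_ge0 ?(ltW L0)//; lra.
  + by rewrite ler_pM2l // E_ge.
  + rewrite lef_pV2 ?posrE// ?D_le// mulr_gt0//; lra.
Qed.

Lemma sonic_approach :
  [/\ forall x, a < x < b -> 0 < Y x,
      exists2 C, 0 < C & forall x, a < x <= (a + b) / 2 -> Y x <= (C * (x - a)) ^+ 2,
      Y x @[x --> b^'-] --> +oo
    & (D x ^+ 2 * Y x) @[x --> b^'-] --> 0].
Proof.
by split; [exact: sonic_gt0|exact: sonic_le_near_end|exact: sonic_pinfty
  |exact: sonic_flux_cvg0].
Qed.

End SonicApproach.

(** * Construction of the profile by inverting a primitive *)

Section Profile.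
Context {R : realType}.
Notation mu := (@lebesgue_measure R).

Lemma antiderivative_oo (a b c : R) (v : R -> R) : a < c < b ->
  (forall x, a < x < b -> {for x, continuous v}) ->
  exists T : R -> R, forall x, a < x < b -> is_derive x 1 T (v x).
Proof.
move=> acb cv.
(* The signed integral from [c]: for [x != c] one of the two intervals is empty and contributes
   0. *)
pose T x := \int[mu]_(t in `[c, x]) v t - \int[mu]_(t in `[x, c]) v t.
exists T => x axb.
(* [[x1, x2]] is a compact interval inside []a, b[] with [x] and [c] in its interior; [v] is
   integrable on it, though possibly not on all of []a, b[]. *)
pose x1 := (a + Num.min x c) / 2.
pose x2 := (b + Num.max x c) / 2.
have [minx minc] : Num.min x c <= x /\ Num.min x c <= c.
  by rewrite !ge_min !lexx orbT.
have [maxx maxc] : x <= Num.max x c /\ c <= Num.max x c.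
  by rewrite !le_max !lexx orbT.
have amin : a < Num.min x c by rewrite lt_min; apply/andP; split; lra.
have maxb : Num.max x c < b by rewrite gt_max; apply/andP; split; lra.
have [ax1 x1x x1c] : [/\ a < x1, x1 < x & x1 < c] by split; rewrite /x1; lra.
have [x2b xx2 cx2] : [/\ x2 < b, x < x2 & c < x2] by split; rewrite /x2; lra.
have iv y z : x1 <= y -> z <= x2 -> mu.-integrable `[y, z] (EFin \o v).
  move=> x1y zx2; apply: continuous_compact_integrable => //.
    exact: segment_compact.
  apply: continuous_in_subspaceT => t; rewrite inE/= in_itv/= => tyz.
  by apply: cv; lra.
pose F y := \int[mu]_(t in `[x1, y]) v t.
have cx : {for x, continuous v} by apply: cv.
have [dF FE] := continuous_FTC1_closed xx2 (iv x1 x2 (lexx _) (lexx _)) x1x cx.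
have dF' : is_derive x 1 F (v x) by apply: DeriveDef => //; rewrite -derive1E.
have FB y z : x1 < y -> y <= z -> z < x2 -> F z - F y = \int[mu]_(t in `[y, z]) v t.
  move=> x1y yz zx2; rewrite /F Rintegral_itvB ?bnd_simp//; last exact: ltW.
    apply: Rintegral_itv_obnd_cbnd.
    apply: integrableS (iv y z _ _) => //; [|exact: ltW|exact: ltW].
    by apply: subset_itvr; rewrite bnd_simp.
  by apply: iv => //; exact: ltW.
have dF2 : is_derive x 1 (fun y => F y - F c) (v x).
  by apply: is_derive_eq; rewrite subr0.
apply: near_eq_is_derive dF2.
have : x \in `]x1, x2[ by rewrite in_itv/= x1x.
move=> /near_in_itvoo; apply: filterS => y; rewrite in_itv/= => /andP[x1y yx2].
rewrite /T; have [cy|yc] := leP c y.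
  rewrite FB//.
  suff -> : \int[mu]_(t in `[y, c]) v t = 0 by rewrite subr0.
  move: cy; rewrite le_eqVlt => /predU1P[->|cy].
    by rewrite set_itv1 Rintegral_set1.
  by rewrite set_itv_ge ?Rintegral_set0// bnd_simp -ltNge.
have -> : \int[mu]_(t in `[c, y]) v t = 0.
  by rewrite set_itv_ge ?Rintegral_set0// bnd_simp -ltNge.
by rewrite sub0r -FB ?(ltW yc)// opprB.
Qed.

(* The profile is the inverse of a primitive of [1 / V]; as [1 / V] tends to 0
   at [s], that primitive is C^1 on the whole interval and the two sides need
   no gluing. *)
Lemma singular_profile_exists (a b s a' b' C : R) (V : R -> R) :
  a < s < b -> 0 < C -> a < a' -> b' < b ->
  (forall x, a < x < b -> x != s -> 0 < V x) ->
  (forall x, a < x < b -> x != s -> {for x, continuous V}) ->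
  V x @[x --> s^'] --> +oo ->
  (forall x, a < x < a' -> V x <= C * (x - a)) ->
  (forall x, b' < x < b -> V x <= C * (b - x)) ->
  exists u : R -> R,
    [/\ u 0 = s, continuous u, forall x, a < u x < b, {homo u : x y / x < y}
      & forall x : R, x != 0 -> is_derive x 1 u (V (u x))] /\
    (u x @[x --> -oo] --> a /\ u x @[x --> +oo] --> b).
Proof.
move=> asb C0 aa' b'b V_gt0 cV Vs Va Vb.
pose v x := if x == s then 0 else (V x)^-1.
have sab : s \in `]a, b[ by rewrite in_itv.
have cv x : a < x < b -> {for x, continuous v}.
  move=> axb; have [->|xs] := eqVneq x s.
    apply/continuous_withinNx; rewrite {2}/v eqxx.
    have : (V x)^-1 @[x --> s^'] --> 0.
      apply/gtr0_cvgV0 => //.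
      near=> y; apply: V_gt0; last by near: y; exact: nbhs_dnbhs_neq.
      have : y \in `]a, b[ by near: y; apply: nbhs_dnbhs; exact: near_in_itvoo.
      by rewrite in_itv.
    apply: cvg_trans; apply: near_eq_cvg; near=> y.
    by rewrite /v ifF//; apply/negbTE; near: y; exact: nbhs_dnbhs_neq.
  have cVx : {for x, continuous (fun y => (V y)^-1)}.
    by apply: continuousV; [rewrite gt_eqF// V_gt0|exact: cV].
  have vx : v x = (V x)^-1 by rewrite /v (negbTE xs).
  rewrite /prop_for /continuous_at vx.
  apply: cvg_trans cVx; apply: near_eq_cvg; near=> y.
  rewrite /v ifF//; apply/negbTE; near: y; exact: near_neq.
have v_ge0 x : a < x < b -> 0 <= v x.
  by rewrite /v => xab; case: eqVneq => // xs; rewrite invr_ge0 ltW// V_gt0.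
have [T0 dT0] := antiderivative_oo asb cv.
pose T x := T0 x - T0 s.
have dT x : a < x < b -> is_derive x 1 T (v x).
  move=> /dT0 dTx; rewrite /T; apply: is_derive_eq; by rewrite subr0.
have cT x : a < x < b -> {for x, continuous T}.
  by move=> /dT; exact: is_derive_continuous.
have wT x y : a < x -> y < b -> {within `[x, y], continuous T}.
  by move=> ax yb; apply: is_derive_within_cc => z zxy; apply: dT; lra.
(* Since [v s = 0], the mean value theorem gives strict increase only on intervals without [s] in
   their interior; [T_lt] chains two of them through [s]. *)
have T_lt1 x y : a < x -> x < y -> y < b -> (y <= s) || (s <= x) -> T x < T y.
  move=> ax xy yb ys.
  have H z : z \in `]x, y[%R -> is_derive z 1 T (v z).
    by rewrite in_itv/= => zxy; apply: dT; lra.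
  have [z zxy TE] := MVT xy H (wT x y ax yb).
  move: zxy; rewrite in_itv/= => zxy.
  rewrite -subr_gt0 TE mulr_gt0 ?subr_gt0// /v ifF.
    rewrite invr_gt0 V_gt0//; first lra.
    by apply/eqP => zs; move: ys; rewrite -zs; lra.
  by apply/eqP => zs; move: ys; rewrite -zs; lra.
have T_lt x y : a < x -> x < y -> y < b -> T x < T y.
  move=> ax xy yb.
  have [ys|sy] := leP y s; first by apply: T_lt1; rewrite ?ys.
  have [sx|xs] := leP s x; first by apply: T_lt1; rewrite ?sx ?orbT.
  apply: (@lt_trans _ _ (T s)); apply: T_lt1; rewrite ?lexx ?orbT//; lra.
have T_le x y : a < x < b -> a < y < b -> T x < T y -> x < y.
  move=> xab yab Txy; rewrite ltNge le_eqVlt; apply/negP => /predU1P[yx|yx].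
    by move: Txy; rewrite yx ltxx.
  by have := T_lt y x; lra.
(* [V x <= C * (x - a)] turns into [v x >= C^-1 / (x - a)]. Divergence at both ends makes [T] onto,
   so its inverse is defined on the whole line. *)
have TNy : T x @[x --> a^'+] --> -oo.
  pose m := Num.min a' s.
  have ms : m <= s by rewrite ge_min lexx orbT.
  have ma' : m <= a' by rewrite ge_min lexx.
  apply: (@log_divergence_right _ T v a m C^-1).
  - by rewrite invr_gt0.
  - by rewrite lt_min aa'; lra.
  - by move=> x xam; apply: dT; lra.
  - move=> x xam; have xs : x < s by lra.
    rewrite /v ifF ?lt_eqF// -invfM lef_pV2 ?posrE.
    + by apply: Va; lra.
    + by rewrite mulr_gt0// subr_gt0; lra.
    + by rewrite V_gt0 ?lt_eqF//; lra.
have Ty : T x @[x --> b^'-] --> +oo.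
  pose m := Num.max b' s.
  have ms : s <= m by rewrite le_max lexx orbT.
  have ma' : b' <= m by rewrite le_max lexx.
  apply: (@log_divergence_left _ T v m b C^-1).
  - by rewrite invr_gt0.
  - by rewrite gt_max b'b; lra.
  - by move=> x xam; apply: dT; lra.
  - move=> x xam; have xs : s < x by lra.
    rewrite /v ifF ?gt_eqF// -invfM lef_pV2 ?posrE.
    + by apply: Vb; lra.
    + by rewrite mulr_gt0// subr_gt0; lra.
    + by rewrite V_gt0 ?gt_eqF//; lra.
have Tsurj y : exists x, a < x < b /\ T x = y.
  move/cvgrNyPlt : TNy => /(_ y) Ny; move/cvgryPgt : Ty => /(_ y) y'.
  have [x1 [x1ab Tx1]] : exists x, a < x < b /\ T x < y.
    near a^'+ => x; exists x; split; last by near: x.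
    apply/andP; split; near: x; [exact: nbhs_right_gt|].
    by apply: nbhs_right_lt; lra.
  have [x2 [x2ab Tx2]] : exists x, a < x < b /\ y < T x.
    near b^'- => x; exists x; split; last by near: x.
    apply/andP; split; near: x; [|exact: nbhs_left_lt].
    by apply: nbhs_left_gt; lra.
  have x12 : x1 < x2 by apply: T_le => //; exact: lt_trans Tx2.
  have wT12 : {within `[x1, x2], continuous T} by apply: wT; lra.
  have T12 : T x1 <= T x2 by rewrite ltW// (lt_trans Tx1).
  have yT : Num.min (T x1) (T x2) <= y <= Num.max (T x1) (T x2).
    by rewrite min_l// max_r// (ltW Tx1) (ltW Tx2).
  have [x + Tx] := IVT (ltW x12) wT12 yT.
  by rewrite in_itv/= => xx; exists x; split => //; lra.
have [u uP] := choice Tsurj.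
have uab y : a < u y < b by case: (uP y).
have Tu y : T (u y) = y by case: (uP y).
have uT x : a < x < b -> u (T x) = x.
  move=> xab; have [h|h|//] := ltgtP (u (T x)) x.
  - by have := T_lt _ _ (proj1 (andP (uab (T x)))) h (proj2 (andP xab)); rewrite Tu ltxx.
  - by have := T_lt _ _ (proj1 (andP xab)) h (proj2 (andP (uab (T x)))); rewrite Tu ltxx.
have nuT x : a < x < b -> {near x, cancel T u}.
  move=> xab; have : x \in `]a, b[ by rewrite in_itv.
  move=> /near_in_itvoo; apply: filterS => y; rewrite in_itv/=; exact: uT.
have ncT x : a < x < b -> {near x, continuous T}.
  move=> xab; have : x \in `]a, b[ by rewrite in_itv.
  move=> /near_in_itvoo; apply: filterS => y; rewrite in_itv/=; exact: cT.
have u_lt x y : x < y -> u x < u y.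
  by move=> xy; apply: T_le => //; rewrite !Tu.
exists u; split; first split => //.
- rewrite (_ : 0 = T s); last by rewrite /T subrr.
  exact: uT.
- move=> y; rewrite -(Tu y).
  by have /nbhs_singleton := near_can_continuous (nuT _ (uab y)) (ncT _ (uab y)).
- move=> x x0.
  have us : u x != s.
    by apply: contra_neq x0 => us; rewrite -(Tu x) us /T subrr.
  have vE : v (u x) = (V (u x))^-1 by rewrite /v (negbTE us).
  have := is_derive_inverse (nuT _ (uab x)) (ncT _ (uab x)) (dT _ (uab x)).
  rewrite vE Tu invrK; apply.
  by rewrite invr_eq0 gt_eqF// V_gt0.
- split; apply/cvgrPdist_lt => e e0.
  + pose r := Num.min ((a + b) / 2) (a + e / 2).
    have rb : r <= (a + b) / 2 by rewrite ge_min lexx.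
    have re : r <= a + e / 2 by rewrite ge_min lexx orbT.
    have ar : a < r by rewrite lt_min; apply/andP; split; lra.
    near=> y.
    have yr : y < T r by near: y; apply: nbhs_ninfty_lt; exact: num_real.
    have : u y < r by apply: T_le => //; [lra|rewrite Tu].
    by rewrite distrC gtr0_norm ?subr_gt0; have := uab y; lra.
  + pose r := Num.max ((a + b) / 2) (b - e / 2).
    have rb : (a + b) / 2 <= r by rewrite le_max lexx.
    have re : b - e / 2 <= r by rewrite le_max lexx orbT.
    have ar : r < b by rewrite gt_max; apply/andP; split; lra.
    near=> y.
    have yr : T r < y by near: y; apply: nbhs_pinfty_gt; exact: num_real.
    have : r < u y by apply: T_le => //; [lra|rewrite Tu].
    by rewrite gtr0_norm ?subr_gt0; have := uab y; lra.
Unshelve. all: by end_near. Qed.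

End Profile.

(** * Integration when the derivative may be unbounded at an endpoint *)

Section SingularFTC.
Context {R : realType}.
Notation mu := (@lebesgue_measure R).
Implicit Types (F f h phi : R -> R) (a b : R).

Lemma integrable_itv_cc f a b a' b' : a <= a' -> b' <= b ->
  mu.-integrable `[a, b] (EFin \o f) -> mu.-integrable `[a', b'] (EFin \o f).
Proof.
move=> aa' bb'; apply: integrableS => //.
by apply: subset_itv; rewrite bnd_simp.
Qed.

(** [F] minus the indefinite integral of [f] is continuous on the closed interval with zero
    derivative inside, so no regularity of [f] at the endpoints enters beyond integrability. *)
Lemma FTC2_oo F f a b : a < b ->
  {within `[a, b], continuous F} ->
  (forall x, a < x < b -> is_derive x 1 F (f x)) ->
  (forall x, a < x < b -> {for x, continuous f}) ->
  mu.-integrable `[a, b] (EFin \o f) ->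
  \int[mu]_(x in `[a, b]) f x = F b - F a.
Proof.
move=> ab cF dF cf intf.
pose I x := \int[mu]_(t in `[a, x]) f t.
have cI : {within `[a, b], continuous I}.
  exact: parameterized_integral_continuous (ltW ab) intf.
have dI x : a < x < b -> is_derive x 1 I (f x).
  move=> xab; have [dIx IE] :=
    continuous_FTC1_closed (proj2 (andP xab)) intf (proj1 (andP xab)) (cf x xab).
  by apply: DeriveDef => //; rewrite -derive1E.
have dFI x : x \in `]a, b[ -> is_derive x 1 (fun y => F y - I y) 0.
  rewrite in_itv/= => xab; have := dF x xab; have := dI x xab => dIx dFx.
  by apply: is_derive_eq; rewrite subrr.
have cFI : {within `[a, b], continuous (fun y => F y - I y)}.
  by move=> x; apply: cvgB; [exact: cF|exact: cI].
have [c _] := @MVT _ (fun y => F y - I y) (fun=> 0) a b ab dFI cFI.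
rewrite mul0r [I a]/I set_itv1 Rintegral_set1 -/(I b); lra.
Qed.

Lemma measurable_fun_cc_of_oo f a b :
  (forall x, a < x < b -> {for x, continuous f}) ->
  measurable_fun `[a, b] f.
Proof.
move=> cf; apply/measurable_fun_itv_bndo_bndcP/measurable_fun_itv_obnd_cbndP.
apply: open_continuous_measurable_fun; first exact: interval_open.
by move=> x; rewrite inE/= in_itv/=; exact: cf.
Qed.

(** On compact subintervals the integral of [f] is an increment of the nondecreasing [F], hence at
    most [F b - F a]; monotone convergence extends the bound. *)
Lemma ge0_derive_integrable F f a b : a < b ->
  {within `[a, b], continuous F} ->
  (forall x, a < x < b -> is_derive x 1 F (f x)) ->
  (forall x, a < x < b -> {for x, continuous f}) ->
  (forall x, a < x < b -> 0 <= f x) ->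
  mu.-integrable `[a, b] (EFin \o f).
Proof.
move=> ab cF dF cf f0.
have mf := measurable_fun_cc_of_oo cf.
have mfoo : measurable_fun `]a, b[ f.
  by apply: measurable_funS mf => //; apply: subset_itv; rewrite bnd_simp.
apply/integrableP; split; first exact/measurable_EFinP.
rewrite integral_itv_bndoo; last first.
  by apply/measurable_EFinP; apply: measurableT_comp.
(* Starting at 3 gives [d n < (b - a) / 2], so every [J n] is nondegenerate. *)
pose d n : R := (b - a) / n.+3%:R.
have dn n : 0 < d n < (b - a) / 2.
  rewrite /d divr_gt0 ?subr_gt0//= ltr_pM2l ?subr_gt0//.
  by rewrite ltf_pV2 ?posrE// ltr_nat.
pose J n := `[a + d n, b - d n]%classic.
have JE : `]a, b[%classic = \bigcup_n J n.
  apply/seteqP; split=> [x|x [n _]]; rewrite /J/= !in_itv/= => xab; last first.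
    by have := dn n; lra.
  pose r := Num.min (x - a) (b - x).
  have r0 : 0 < r by rewrite lt_min; apply/andP; split; lra.
  pose n := Num.truncn ((b - a) / r).
  have dr : d n < r.
    rewrite /d ltr_pdivrMr// mulrC -ltr_pdivrMr//.
    apply: (@lt_le_trans _ _ n.+1%:R); last by rewrite ler_nat ltnS -addn2 leq_addr.
    exact: (@truncnS_gt R).
  have rx : r <= x - a by rewrite ge_min lexx.
  have rb : r <= b - x by rewrite ge_min lexx orbT.
  by exists n => //=; rewrite in_itv/=; lra.
have cvJ := @ge0_nondecreasing_set_cvg_integral _ (measurableTypeR R) R J
  (EFin \o f) mu.
rewrite JE.
have fE : forall x, (\bigcup_n J n) x -> `|(f x)%:E|%E = (f x)%:E.
  by move=> x; rewrite -JE/= in_itv/= => xab; rewrite ger0_norm// f0.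
under eq_integral => x xJ do rewrite (fE x (set_mem xJ)).
have JS n : J n `<=` `]a, b[.
  by rewrite JE => x ?; exists n.
apply: (@le_lt_trans _ _ (F b - F a)%:E); last exact: ltry.
apply: (cvge_to_le (cvJ _ _ _ _)).
- move=> n m nm; rewrite subsetEset.
  have dnm : d m <= d n by rewrite ler_pM2l ?subr_gt0// lef_pV2 ?posrE// ler_nat !ltnS.
  by apply: subset_itv; rewrite bnd_simp; lra.
- by move=> n; exact: measurable_itv.
- move=> n; apply/measurable_EFinP; apply: measurable_funS mfoo => //.
- move=> n x /JS xab; have {}xab : a < x < b by move: xab => /=; rewrite in_itv.
  by rewrite /= lee_fin f0.
apply: nearW => n.
have dn' := dn n.
have ab' : a + d n < b - d n by lra.
have iJ : mu.-integrable (J n) (EFin \o f).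
  apply: continuous_compact_integrable => //.
    exact: segment_compact.
  apply: continuous_in_subspaceT => t; rewrite inE /J/= in_itv/= => tyz.
  by apply: cf; lra.
have Fmono x y : a <= x -> x <= y -> y <= b -> F x <= F y.
  move=> ax xy yb; apply: (@is_derive_ge0_le _ F f) => //.
  - by move=> z zxy; apply: dF; lra.
  - by apply: continuous_subspaceW cF; apply: subset_itv; rewrite bnd_simp.
  - by move=> z zxy; apply: f0; lra.
have IE : (\int[mu]_(x in J n) (EFin \o f) x = (F (b - d n) - F (a + d n))%:E)%E.
  have H1 : {within `[a + d n, b - d n], continuous F}.
    by apply: continuous_subspaceW cF; apply: subset_itv; rewrite bnd_simp; lra.
  have H2 x : a + d n < x < b - d n -> is_derive x 1 F (f x).
    by move=> xx; apply: dF; lra.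
  have H3 x : a + d n < x < b - d n -> {for x, continuous f}.
    by move=> xx; apply: cf; lra.
  by rewrite -(FTC2_oo ab' H1 H2 H3 iJ) /Rintegral fineK// integrable_fin_num.
suff : (\int[mu]_(x in J n) (EFin \o f) x <= (F b - F a)%:E)%E by [].
rewrite IE lee_fin.
have a1 : a <= a + d n by lra.
have a2 : a + d n <= b by lra.
have b1 : a <= b - d n by lra.
have b2 : b - d n <= b by lra.
have := Fmono a (a + d n) (lexx a) a1 a2.
have := Fmono (b - d n) b b1 b2 (lexx b); lra.
Qed.

Lemma integrable_cat_cc f a c b : a <= c -> c <= b ->
  mu.-integrable `[a, c] (EFin \o f) -> mu.-integrable `[c, b] (EFin \o f) ->
  mu.-integrable `[a, b] (EFin \o f).
Proof.
move=> ac cb /integrableP[m1 i1] /integrableP[m2 i2].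
have E : `[a, b]%classic = `[a, c]%classic `|` `]c, b]%classic.
  apply/seteqP; split=> [x|x []]; rewrite /= !in_itv/= => xab; [|lra|lra].
  by have [xc|cx] := leP x c; [left|right]; lra.
have m3 : measurable_fun `]c, b] (EFin \o f).
  by apply: measurable_funS m2 => //; apply: subset_itv; rewrite bnd_simp.
have mab : measurable_fun `[a, b] (EFin \o f).
  by rewrite E; apply/measurable_funU.
have mabs (A : set R) : measurable_fun A (EFin \o f) ->
    measurable_fun A (fun x => (`|f x|)%:E).
  move=> /measurable_EFinP mA; apply/measurable_EFinP.
  exact: measurableT_comp.
apply/integrableP; split => //.
rewrite E ge0_integral_setU//=.
- apply: lte_add_pinfty => //; apply: le_lt_trans i2.
  apply: ge0_subset_integral => //; first exact: mabs.
  by apply: subset_itv; rewrite bnd_simp.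
- by rewrite -E; exact: mabs.
- apply/disj_set2P/seteqP; split=> // x [] /=; rewrite !in_itv/=; lra.
Qed.

Section CompactSupport.
Variables (h : R -> R) (M : R).
Hypothesis h0 : forall x, x \notin `[- M, M] -> h x = 0.
Hypothesis ih : mu.-integrable `[- M, M] (EFin \o h).

Let hE : h = h \_ `[- M, M].
Proof.
apply/funext => x; rewrite patchE; case: ifPn => //.
by rewrite notin_setE/= => /negP/h0.
Qed.

Lemma integrable_compact_support : mu.-integrable setT (EFin \o h).
Proof.
by rewrite hE -restrict_EFin; apply/integrable_restrict => //=; rewrite setTI.
Qed.

Lemma Rintegral_compact_support :
  \int[mu]_x h x = \int[mu]_(x in `[- M, M]) h x.
Proof. by rewrite [RHS]Rintegral_mkcond -hE. Qed.

End CompactSupport.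

Lemma test_function_support phi (x0 : R) : test_function phi ->
  exists2 M : R, `|x0| < M & forall x, M <= `|x| -> phi x = 0 /\ derive1 phi x = 0.
Proof.
move=> [_ /compact_bounded[M0 [_ HM]]].
pose M := `|M0| + `|x0| + 1.
have MM0 : M0 < M by rewrite /M; have := ler_norm M0; have := normr_ge0 x0; lra.
have out x : M < `|x| -> phi x = 0.
  move=> Mx; apply/eqP; apply: contraTT Mx => phix; rewrite -leNgt.
  by apply: (HM _ MM0); apply: subset_closure.
(* The extra unit yields the strict, hence open, condition [M < |x|]: [phi] vanishes near [x], and
   so does its derivative at [x]. *)
exists (M + 1) => [|x Mx]; first by rewrite /M; have := normr_ge0 M0; lra.
have Mx' : M < `|x| by lra.
split; first exact: out.
rewrite derive1E (@near_eq_derive _ _ _ phi (cst 0)) ?derive_cst//.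
have /cvgr_gt/(_ _ Mx') : `|y| @[y --> x] --> `|x| by exact: norm_continuous.
by apply: filterS => y /out.
Qed.

Lemma test_function_C1 phi : test_function phi ->
  [/\ continuous phi, continuous (derive1 phi)
    & forall x : R, is_derive x 1 phi (derive1 phi x)].
Proof.
move=> [phiC _]; have [d c] := phiC 1%N; split=> x.
- exact: (c 0%N x).
- exact: (c 1%N x).
- by rewrite derive1E; apply/derivableP; exact: (d 0%N x).
Qed.

(* The derivative may blow up at [x0], and its value there is irrelevant. *)
Lemma integration_by_parts_test F f (x0 : R) phi :
  continuous F ->
  (forall x : R, x != x0 -> is_derive x 1 F (f x)) ->
  (forall x, x != x0 -> {for x, continuous f}) ->
  (forall a b, mu.-integrable `[a, b] (EFin \o f)) ->
  test_function phi ->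
  [/\ mu.-integrable setT (EFin \o (fun x => F x * derive1 phi x)),
      mu.-integrable setT (EFin \o (fun x => f x * phi x))
    & \int[mu]_x (F x * derive1 phi x) = - \int[mu]_x (f x * phi x)].
Proof.
move=> cF dF cf intf tphi.
have [cphi cdphi dphi] := test_function_C1 tphi.
have [M x0M phi0] := test_function_support x0 tphi.
have M0 : 0 < M by apply: le_lt_trans x0M.
have [Mx0 x0M'] : - M < x0 /\ x0 < M by apply/andP; rewrite -ltr_norml.
have out x : x \notin `[- M, M] -> phi x = 0 /\ derive1 phi x = 0.
  rewrite in_itv/= -ler_norml -ltNge => Mx; apply: phi0; exact: ltW.
have cc h a b : continuous h -> mu.-integrable `[a, b] (EFin \o h).
  move=> ch; apply: continuous_compact_integrable; first exact: segment_compact.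
  by apply: continuous_subspaceT.
have c1 : continuous (fun x => F x * derive1 phi x).
  by move=> x; apply: cvgM; [exact: cF|exact: cdphi].
have i2 a b : mu.-integrable `[a, b] (EFin \o (fun x => f x * phi x)).
  have -> : EFin \o (fun x => f x * phi x) = ((EFin \o f) \* (EFin \o phi))%E by [].
  apply: integrableMl => //.
  - by apply: measurable_funS (continuous_measurable_fun cphi).
  - have : compact (phi @` `[a, b]).
      apply: continuous_compact; last exact: segment_compact.
      exact: continuous_subspaceT.
    move=> /compact_bounded[K [Kr HK]]; exists K; split=> // z Kz x xab.
    by apply: (HK z Kz); exists x.
pose g1 x := F x * derive1 phi x; pose g2 x := f x * phi x.
pose g x := g1 x + g2 x.
have ig a b : mu.-integrable `[a, b] (EFin \o g).
  have -> : EFin \o g = ((EFin \o g1) \+ (EFin \o g2))%E by [].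
  by apply: integrableD => //; exact: cc.
have dg x : x != x0 -> is_derive x 1 (fun y => F y * phi y) (g x).
  move=> /dF dFx; have := dphi x => dphix; apply: is_derive_eq.
  by rewrite /g /g1 /g2 /GRing.scale/= [phi x * _]mulrC.
have cg x : x != x0 -> {for x, continuous g}.
  move=> xx0; apply: cvgD; first exact: c1.
  by apply: cvgM; [exact: cf|exact: cphi].
have cFphi a b : {within `[a, b], continuous (fun y => F y * phi y)}.
  by apply: continuous_subspaceT => x; apply: cvgM; [exact: cF|exact: cphi].
have phiM : phi M = 0 by apply: (proj1 (phi0 _ _)); rewrite gtr0_norm.
have phiNM : phi (- M) = 0 by apply: (proj1 (phi0 _ _)); rewrite normrN gtr0_norm.
(* Because [phi] vanishes at both ends [- M] and [M], each half leaves only its boundary term at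
   [x0]; the two cancel as [F] is continuous there. *)
have I1 : \int[mu]_(x in `[- M, x0]) g x = F x0 * phi x0.
  have H1 x : - M < x < x0 -> is_derive x 1 (fun y => F y * phi y) (g x).
    by move=> xM; apply: dg; rewrite lt_eqF//; lra.
  have H2 x : - M < x < x0 -> {for x, continuous g}.
    by move=> xM; apply: cg; rewrite lt_eqF//; lra.
  by rewrite (FTC2_oo Mx0 (cFphi _ _) H1 H2 (ig _ _)) phiNM mulr0 subr0.
have I2 : \int[mu]_(x in `[x0, M]) g x = - (F x0 * phi x0).
  have H1 x : x0 < x < M -> is_derive x 1 (fun y => F y * phi y) (g x).
    by move=> xM; apply: dg; rewrite gt_eqF//; lra.
  have H2 x : x0 < x < M -> {for x, continuous g}.
    by move=> xM; apply: cg; rewrite gt_eqF//; lra.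
  by rewrite (FTC2_oo x0M' (cFphi _ _) H1 H2 (ig _ _)) phiM mulr0 sub0r.
have I0 : \int[mu]_(x in `[- M, M]) g x = 0.
  have := @Rintegral_itvB _ g (BLeft (- M)) (BRight M) x0 (ig _ _).
  rewrite !bnd_simp => /(_ (ltW Mx0) (ltW x0M')).
  rewrite I1 Rintegral_itv_obnd_cbnd ?I2; first lra.
  apply: integrableS (ig x0 M) => //.
  by apply: subset_itvr; rewrite bnd_simp.
have o1 x : x \notin `[- M, M] -> F x * derive1 phi x = 0.
  by move=> /out[_ ->]; rewrite mulr0.
have o2 x : x \notin `[- M, M] -> f x * phi x = 0.
  by move=> /out[-> _]; rewrite mulr0.
split.
- exact: (integrable_compact_support o1 (cc _ _ _ c1)).
- exact: (integrable_compact_support o2 (i2 _ _)).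
- rewrite (Rintegral_compact_support o1) (Rintegral_compact_support o2).
  apply/eqP; rewrite -addr_eq0 -RintegralD//; last exact: cc.
  exact/eqP.
Qed.

Lemma measurable_fun_off_point f (x0 : R) :
  (forall x, x != x0 -> {for x, continuous f}) -> measurable_fun setT f.
Proof.
move=> cf.
have E : setT = `]-oo, x0]%classic `|` `]x0, +oo[%classic :> set R.
  apply/seteqP; split=> // x _; rewrite /= !in_itv/= andbT.
  by have [] := leP x x0; [left|right].
rewrite E; apply/measurable_funU => //; split.
  apply/measurable_fun_itv_bndo_bndcP; apply: open_continuous_measurable_fun.
    exact: interval_open.
  by move=> x; rewrite inE/= in_itv/= => xx0; apply: cf; rewrite lt_eqF.
apply: open_continuous_measurable_fun; first exact: interval_open.
by move=> x; rewrite inE/= in_itv/= andbT => xx0; apply: cf; rewrite gt_eqF.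
Qed.

Lemma locally_integrable_of_cc f : measurable_fun setT f ->
  (forall a b, mu.-integrable `[a, b] (EFin \o f)) -> locally_integrable setT f.
Proof.
move=> mf intf; split=> //; first exact: openT.
move=> K _ cK; have /compact_bounded[M0 [_ HM]] := cK.
have KS : K `<=` `[- (M0 + 1), M0 + 1].
  by move=> x Kx /=; rewrite in_itv/= -ler_norml; apply: HM => //; rewrite ltrDl.
have /integrableP[m1] := intf (- (M0 + 1)) (M0 + 1).
apply: le_lt_trans; apply: ge0_subset_integral => //.
- exact: compact_measurable.
- apply/measurable_EFinP; apply: measurableT_comp => //.
  exact: measurable_funS mf.
Qed.

End SingularFTC.

Lemma is_derive_powV {R : realType} (n : nat) (r : R) : r != 0 ->
  is_derive r 1 (fun t => (t ^+ n.+1)^-1) (- n.+1%:R / r ^+ n.+2).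
Proof.
move=> r0; have rn0 : r ^+ n.+1 != 0 by rewrite expf_neq0.
have dX : is_derive r 1 (fun t => t ^+ n.+1) (n.+1%:R * r ^+ n).
  apply: DeriveDef; first exact: exprn_derivable.
  by rewrite exp_derive /GRing.scale/= mulr1.
have := @is_deriveV _ (fun t => t ^+ n.+1) r _ 1 rn0 dX.
suff -> : - (r ^+ n.+1) ^- 2 *: (n.+1%:R * r ^+ n) = - n.+1%:R / r ^+ n.+2 by [].
rewrite /GRing.scale/= [r ^+ n.+2]exprS [r ^+ n.+1]exprS; field.
by rewrite r0 expf_neq0.
Qed.

(** The common shape of [S] ([n = 0], [M = - m ^+ 2]) and of [S'] ([n = 1], [M = m ^+ 2]). *)
Lemma is_derive_affine_inv {R : realType} (k M : R) (n : nat) (f : R -> R) (df r : R) :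
  r != 0 -> is_derive r 1 f df ->
  is_derive r 1 (fun t => k + M / t ^+ n.+1 - f t)
    (- (n.+1%:R * M / r ^+ n.+2) - df).
Proof.
move=> r0 dfr; have dV := is_derive_powV n r0.
apply: is_derive_eq; rewrite /GRing.scale/= add0r; congr (_ - _).
by ring.
Qed.

Lemma is_derive_div_sqr {R : realType} (Z : R -> R) (dZ r : R) : r != 0 ->
  is_derive r 1 Z dZ ->
  is_derive r 1 (fun t => Z t / t ^+ 2) (dZ / r ^+ 2 - 2 * Z r / r ^+ 3).
Proof.
move=> r0 dZr; have dV := is_derive_powV 1 r0.
by apply: is_derive_eq; rewrite /GRing.scale/=; field.
Qed.

(** * The function [S] at the end states and its two derivatives *)

Section ShockFacts.
Context {R : realType} (s : shock_data R) (Rs : R).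
Hypothesis hs : standing_setting s Rs.

Local Notation m := (sd_m s).
Local Notation Rm := (Rm s).
Local Notation Rp := (Rp s).
Local Notation S := (calS s).
Local Notation ddp := (derive1n 2 (pressure s)).

(** Closed form of [S'], valid for [r > 0], which can itself be differentiated by rule. *)
Definition dcalS (r : R) : R := m ^+ 2 / r ^+ 2 - derive1 (pressure s) r.
Local Notation dS := dcalS.

(** Eliminating [c], [q] and [k] by the three jump relations shows that the reduced energy at [rho]
    is the specific energy of the end state, so the reduced pressure there is the physical one. *)
Lemma calS_end (rho U E : R) : 0 < rho -> rankine_hugoniot s rho U E -> S rho = 0.
Proof.
move=> rho0 [RH1 RH2 RH3]; have m0 := m_neq0 hs.
have rho_neq0 : rho != 0 by rewrite gt_eqF.
set p := sd_ptilde s rho _ in RH2 RH3.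
have cE : sd_c s = U - m / rho.
  by rewrite -RH1; field.
have qE : sd_q s = m * U + p by [].
have energyE : energy s rho = specific_energy rho U E.
  by rewrite /energy /e0 /specific_energy -RH3 qE cE; field; rewrite rho_neq0.
by rewrite /calS /pressure energyE -/p qE cE; field.
Qed.

Lemma calS_Rm : S Rm = 0.
Proof. exact: calS_end (Rm_gt0 hs) (RH_minus hs). Qed.

Lemma calS_Rp : S Rp = 0.
Proof. exact: calS_end (Rp_gt0 hs) (RH_plus hs). Qed.

Lemma is_derive_pressure (r : R) : 0 < r ->
  is_derive r 1 (pressure s) (derive1 (pressure s) r).
Proof.
move=> r0; rewrite derive1E; apply/derivableP.
exact: ((pressure_C2 hs).1 0%N r).
Qed.

Lemma is_derive_dpressure (r : R) : 0 < r ->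
  is_derive r 1 (derive1 (pressure s)) (ddp r).
Proof.
move=> r0; rewrite derive1nS derive1E; apply/derivableP.
exact: ((pressure_C2 hs).1 1%N r).
Qed.

Lemma continuous_ddp (r : R) : 0 < r -> {for r, continuous ddp}.
Proof. by move=> r0; exact: ((pressure_C2 hs).2 2%N r). Qed.

Lemma is_derive_calS (r : R) : 0 < r -> is_derive r 1 S (dS r).
Proof.
move=> r0; have r_neq0 : r != 0 by rewrite gt_eqF.
have := is_derive_affine_inv (sd_q s - m * sd_c s) (- m ^+ 2) 0
  r_neq0 (is_derive_pressure r0).
have -> : - (1 * - m ^+ 2 / r ^+ 2) - derive1 (pressure s) r = dS r.
  by rewrite /dcalS mul1r mulNr opprK.
suff -> : (fun t : R => sd_q s - m * sd_c s + - m ^+ 2 / t ^+ 1 - pressure s t) = S.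
  by [].
by apply/funext => t; rewrite /calS mulNr expr1.
Qed.

Lemma derive1_calS (r : R) : 0 < r -> derive1 S r = dS r.
Proof. by move=> /is_derive_calS[_ <-]; rewrite derive1E. Qed.

Lemma is_derive_dcalS (r : R) : 0 < r ->
  is_derive r 1 dS (- (2 * m ^+ 2 / r ^+ 3 + ddp r)).
Proof.
move=> r0; have r_neq0 : r != 0 by rewrite gt_eqF.
have := is_derive_affine_inv 0 (m ^+ 2) 1 r_neq0 (is_derive_dpressure r0).
rewrite -opprD.
suff -> : (fun t : R => 0 + m ^+ 2 / t ^+ 2 - derive1 (pressure s) t) = dS by [].
by apply/funext => t; rewrite /dcalS add0r.
Qed.

Lemma dcalS_Rs : dS Rs = 0.
Proof.
have Rs0 : 0 < Rs.
  by have := Rs_between hs; have := Rm_gt0 hs; lra.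
by rewrite -derive1_calS//; apply/(Rs_unique_zero hs).
Qed.

(** Supplies the Lipschitz constant [L] of [S'], by continuity on a compact interval. *)
Lemma ddp_bounded : exists L : R, forall r, Rm <= r <= Rp ->
  2 * m ^+ 2 / r ^+ 3 + ddp r <= L.
Proof.
have [c _ cmax] : exists2 c, c \in `[Rm, Rp] &
    forall t, t \in `[Rm, Rp] ->
      2 * m ^+ 2 / t ^+ 3 + ddp t <= 2 * m ^+ 2 / c ^+ 3 + ddp c.
  apply: (@EVT_max _ (fun r => 2 * m ^+ 2 / r ^+ 3 + ddp r)).
    exact: ltW (Rm_lt_Rp hs).
  apply: continuous_in_subspaceT => r; rewrite inE/= in_itv/= => /andP[Rmr _].
  have r0 : 0 < r by apply: lt_le_trans Rmr; exact: Rm_gt0 hs.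
  apply: cvgD; last exact: continuous_ddp.
  apply: cvgM; first exact: cvg_cst.
  apply: cvgV; first by rewrite expf_neq0// gt_eqF.
  exact: exprn_continuous.
exists (2 * m ^+ 2 / c ^+ 3 + ddp c) => r rmp.
by apply: cmax; rewrite in_itv.
Qed.

End ShockFacts.

(** * Sign and asymptotics of the canonical solutions *)

Section CanonicalSolutions.
Context {R : realType} (s : shock_data R) (Rs : R).
Hypothesis hs : standing_setting s Rs.

Local Notation alpha := (sd_alpha s).
Local Notation m := (sd_m s).
Local Notation Rm := (Rm s).
Local Notation Rp := (Rp s).
Local Notation S := (calS s).
Local Notation dS := (dcalS s).
Local Notation ddp := (derive1n 2 (pressure s)).

(** The [- 2 / r] part of [odeP] produces [2 Z / r ^+ 3], which cancels the term coming from the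
    derivative of [1 / r ^+ 2]. *)
Lemma canonical_ode_div_sqr (Z : R -> R) (r : R) : r != 0 -> dS r != 0 ->
  derive1 S r = dS r ->
  (odeQ s r - odeP s r * Z r) / r ^+ 2 - 2 * Z r / r ^+ 3 =
  2 / alpha / r ^+ 2 * S r / dS r + 2 * ddp r / dS r * (Z r / r ^+ 2).
Proof.
move=> r0 d0 dE; rewrite /odeQ /odeP dE.
have alpha0 : alpha != 0 by rewrite gt_eqF// (alpha_gt0 hs).
move: (derive1n 2 (pressure s) r) (S r) (dS r) d0 => p S0 d d0.
by field; rewrite r0 d0.
Qed.

Lemma dcalS_neq0 (r : R) : 0 < r -> r != Rs -> dS r != 0.
Proof.
move=> r0; apply: contra_neq => dSr; apply/(Rs_unique_zero hs r0).
by rewrite (derive1_calS hs).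
Qed.

Lemma canonical_minus_cvg (Z : R -> R) : canonical_minus s Rs Z ->
  Z r @[r --> Rm^'+] --> 0.
Proof.
move=> [_ cZ _ ZRm]; have RsB := Rs_between hs.
have : {within `[Rm, (Rm + Rs) / 2], continuous Z}.
  by apply: continuous_subspaceW cZ; apply: subset_itv; rewrite bnd_simp//; lra.
have ab : Rm < (Rm + Rs) / 2 by lra.
by move=> /(continuous_within_itvP _ ab)[_ + _]; rewrite ZRm.
Qed.

Lemma canonical_plus_cvg (Z : R -> R) : canonical_plus s Rs Z ->
  Z r @[r --> Rp^'-] --> 0.
Proof.
move=> [_ cZ _ ZRp]; have RsB := Rs_between hs.
have : {within `[(Rs + Rp) / 2, Rp], continuous Z}.
  by apply: continuous_subspaceW cZ; apply: subset_itv; rewrite bnd_simp//; lra.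
have ab : (Rs + Rp) / 2 < Rp by lra.
by move=> /(continuous_within_itvP _ ab)[_ _ +]; rewrite ZRp.
Qed.

Lemma canonical_minusP (Z : R -> R) : canonical_minus s Rs Z ->
  [/\ forall r, Rm < r < Rs -> 0 < Z r,
      exists2 C, 0 < C &
        forall r, Rm < r <= (Rm + Rs) / 2 -> Num.sqrt (Z r) <= C * (r - Rm),
      Z r @[r --> Rs^'-] --> +oo
    & (dS r ^+ 2 * (Z r / r ^+ 2)) @[r --> Rs^'-] --> 0].
Proof.
move=> hZ; have [[dZ _] _ odeZ ZRm] := hZ.
have Rm0 := Rm_gt0 hs; have RsB := Rs_between hs; have alpha0 := alpha_gt0 hs.
have RmRs : Rm < Rs by lra.
have Rs0 : 0 < Rs by lra.
have m2 : 0 < m ^+ 2 by rewrite exprn_even_gt0//= (m_neq0 hs).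
have m22 : 0 < 2 * m ^+ 2 by lra.
have [L HL] := ddp_bounded hs.
have dZ' r : Rm < r < Rs -> is_derive r 1 Z (odeQ s r - odeP s r * Z r).
  move=> rab; rewrite -(odeZ r rab) addrK derive1E; apply/derivableP.
  by apply: (dZ 0%N r) => //; rewrite /= in_itv.
pose E r := 2 * m ^+ 2 / r ^+ 3.
pose A r := 2 / alpha / r ^+ 2.
pose Y r := Z r / r ^+ 2.
(* [E] and [A] decrease in [r], so their lower bounds on [[Rm, Rs]] are the values at [Rs], and
   [A Rm] is the upper bound of [A]. *)
have e0 : 0 < E Rs by rewrite divr_gt0 ?exprn_gt0.
have A0 : 0 < A Rs by rewrite !divr_gt0 ?exprn_gt0.
have h1 r : Rm <= r <= Rs -> is_derive r 1 S (dS r).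
  by move=> rb; apply: (is_derive_calS hs); lra.
have h2 r : Rm <= r <= Rs -> is_derive r 1 dS (- (E r + ddp r)).
  by move=> rb; apply: (is_derive_dcalS hs); lra.
have h3 r : Rm <= r <= Rs -> E Rs <= E r.
  move=> rb; have r0 : 0 < r by lra.
  rewrite /E ler_pM2l// lef_pV2 ?posrE ?exprn_gt0//.
  by rewrite lerXn2r ?nnegrE ?(ltW r0) ?(ltW Rs0)//; lra.
have h4 r : Rm <= r <= Rs -> 0 <= ddp r.
  by move=> rb; apply: (ddp_ge0 hs); lra.
have h5 r : Rm <= r <= Rs -> E r + ddp r <= L by move=> rb; apply: HL; lra.
have h6 r : Rm <= r <= Rs -> A Rs <= A r <= A Rm.
  move=> rb; have r0 : 0 < r by lra.
  have a0 : 0 < 2 / alpha by rewrite divr_gt0.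
  rewrite /A !ler_pM2l// !lef_pV2 ?posrE ?exprn_gt0//.
  by rewrite !lerXn2r ?nnegrE ?(ltW Rm0) ?(ltW r0) ?(ltW Rs0)//; lra.
have h7 r : Rm < r < Rs ->
    is_derive r 1 Y (A r * S r / dS r + 2 * ddp r / dS r * Y r).
  move=> rb; have r0 : 0 < r by lra.
  have r_neq0 : r != 0 by rewrite gt_eqF.
  have := is_derive_div_sqr r_neq0 (dZ' r rb).
  rewrite canonical_ode_div_sqr ?(derive1_calS hs)//.
  by apply: dcalS_neq0 => //; rewrite lt_eqF//; lra.
have Ya : Y Rm = 0 by rewrite /Y ZRm mul0r.
have cZRm := canonical_minus_cvg hZ.
have cV : (r ^+ 2)^-1 @[r --> Rm] --> (Rm ^+ 2)^-1.
  apply: cvgV; first by rewrite expf_neq0// gt_eqF.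
  exact: exprn_continuous.
have cY : Y r @[r --> Rm^'+] --> 0.
  rewrite -[0](mul0r (Rm ^+ 2)^-1); apply: cvgM => //.
  exact: cvg_at_right_filter.
have [Y_gt0 [C C0 YC] Yoo flux0] := sonic_approach RmRs e0 A0 h1 h2 h3 h4 h5 h6
  (dcalS_Rs hs) (calS_Rm hs) h7 Ya cY.
have Z_gt0 r : Rm < r < Rs -> 0 < Z r.
  move=> rb; have := Y_gt0 r rb; rewrite /Y pmulr_lgt0// invr_gt0 exprn_gt0//; lra.
have ZE r : Rm < r -> Z r = Y r * r ^+ 2.
  by move=> rb; rewrite /Y divfK// expf_neq0// gt_eqF//; lra.
split=> //.
- exists (C * Rs) => [|r rb]; first by rewrite mulr_gt0.
  have rab : Rm < r < Rs by lra.
  have H : Z r <= (C * Rs * (r - Rm)) ^+ 2.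
    rewrite ZE; last by lra.
    have r2 : r ^+ 2 <= Rs ^+ 2 by rewrite lerXn2r ?nnegrE//; lra.
    have -> : (C * Rs * (r - Rm)) ^+ 2 = (C * (r - Rm)) ^+ 2 * Rs ^+ 2 by ring.
    apply: ler_pM => //; [exact: ltW (Y_gt0 _ _)|exact: sqr_ge0|exact: YC].
  apply: (le_trans (ler_wsqrtr H)); rewrite sqrtr_sqr ger0_norm//.
  by rewrite mulr_ge0 ?subr_ge0 ?mulr_ge0 ?(ltW C0) ?(ltW Rs0)//; lra.
- apply/cvgryPge => M; move/cvgryPge : Yoo => /(_ (M / Rm ^+ 2)) YM.
  near=> r.
  have rRm : Rm < r by near: r; apply: nbhs_left_gt.
  have rRs : r < Rs by near: r; apply: nbhs_left_lt.
  have rb : Rm < r < Rs by rewrite rRm.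
  have H1 : M <= Y r * Rm ^+ 2.
    by rewrite -ler_pdivrMr ?exprn_gt0//; near: r.
  apply: (le_trans H1); rewrite ZE// ler_wpM2l ?(ltW (Y_gt0 _ _))//.
  by rewrite lerXn2r ?nnegrE//; lra.
Unshelve. all: by end_near. Qed.

(* The reflection [r -> - r] turns the right branch into a left one. *)
Lemma canonical_plusP (Z : R -> R) : canonical_plus s Rs Z ->
  [/\ forall r, Rs < r < Rp -> 0 < Z r,
      exists2 C, 0 < C &
        forall r, (Rs + Rp) / 2 <= r < Rp -> Num.sqrt (Z r) <= C * (Rp - r),
      Z r @[r --> Rs^'+] --> +oo
    & (dS r ^+ 2 * (Z r / r ^+ 2)) @[r --> Rs^'+] --> 0].
Proof.
move=> hZ; have [[dZ _] _ odeZ ZRp] := hZ.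
have Rm0 := Rm_gt0 hs; have RsB := Rs_between hs; have alpha0 := alpha_gt0 hs.
have RsRp : - Rp < - Rs by lra.
have Rs0 : 0 < Rs by lra.
have Rp0 : 0 < Rp by lra.
have m2 : 0 < m ^+ 2 by rewrite exprn_even_gt0//= (m_neq0 hs).
have m22 : 0 < 2 * m ^+ 2 by lra.
have [L HL] := ddp_bounded hs.
have dZ' r : Rs < r < Rp -> is_derive r 1 Z (odeQ s r - odeP s r * Z r).
  move=> rab; rewrite -(odeZ r rab) addrK derive1E; apply/derivableP.
  by apply: (dZ 0%N r) => //; rewrite /= in_itv.
pose E r := 2 * m ^+ 2 / r ^+ 3.
pose A r := 2 / alpha / r ^+ 2.
pose Y r := Z r / r ^+ 2.
have e0 : 0 < E Rp by rewrite divr_gt0 ?exprn_gt0.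
have A0 : 0 < A Rp by rewrite !divr_gt0 ?exprn_gt0.
(* After reflection the role of [D] is played by [- S'(- x)], again the derivative of the reflected
   [S]. *)
have h1 x : - Rp <= x <= - Rs -> is_derive x 1 (fun x => S (- x)) (- dS (- x)).
  by move=> xb; apply: is_derive_reflect; apply: (is_derive_calS hs); lra.
have h2 x : - Rp <= x <= - Rs ->
    is_derive x 1 (fun x => - dS (- x)) (- (E (- x) + ddp (- x))).
  move=> xb; apply: is_deriveN; rewrite -[E _ + _]opprK; apply: is_derive_reflect.
  by apply: (is_derive_dcalS hs); lra.
have h3 x : - Rp <= x <= - Rs -> E Rp <= E (- x).
  move=> xb; have r0 : 0 < - x by lra.
  rewrite /E ler_pM2l// lef_pV2 ?posrE ?exprn_gt0//.
  by rewrite lerXn2r ?nnegrE ?(ltW r0) ?(ltW Rp0)//; lra.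
have h4 x : - Rp <= x <= - Rs -> 0 <= ddp (- x).
  by move=> xb; apply: (ddp_ge0 hs); lra.
have h5 x : - Rp <= x <= - Rs -> E (- x) + ddp (- x) <= L.
  by move=> xb; apply: HL; lra.
have h6 x : - Rp <= x <= - Rs -> A Rp <= A (- x) <= A Rs.
  move=> xb; have r0 : 0 < - x by lra.
  have a0 : 0 < 2 / alpha by rewrite divr_gt0.
  rewrite /A !ler_pM2l// !lef_pV2 ?posrE ?exprn_gt0//.
  by rewrite !lerXn2r ?nnegrE ?(ltW Rp0) ?(ltW r0) ?(ltW Rs0)//; lra.
have h7 x : - Rp < x < - Rs -> is_derive x 1 (fun x => Y (- x))
    (A (- x) * S (- x) / (- dS (- x)) + 2 * ddp (- x) / (- dS (- x)) * Y (- x)).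
  move=> xb; have r0 : 0 < - x by lra.
  have rb : Rs < - x < Rp by lra.
  have r_neq0 : - x != 0 by rewrite gt_eqF.
  have := is_derive_div_sqr r_neq0 (dZ' _ rb).
  rewrite canonical_ode_div_sqr ?(derive1_calS hs)//; last first.
    by apply: dcalS_neq0 => //; rewrite gt_eqF//; lra.
  move=> /is_derive_reflect; rewrite -/(Y _) -/(A _).
  by rewrite invrN !mulrN mulNr opprD.
have Ya : Y (- - Rp) = 0 by rewrite opprK /Y ZRp mul0r.
have cZRp := canonical_plus_cvg hZ.
have cV : (r ^+ 2)^-1 @[r --> Rp] --> (Rp ^+ 2)^-1.
  apply: cvgV; first by rewrite expf_neq0// gt_eqF.
  exact: exprn_continuous.
have cY : Y (- x) @[x --> (- Rp)^'+] --> 0.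
  apply/(cvg_at_leftNP Y Rp 0); rewrite -[0](mul0r (Rp ^+ 2)^-1); apply: cvgM => //.
  exact: cvg_at_left_filter.
have D0 : - dS (- - Rs) = 0 by rewrite opprK (dcalS_Rs hs) oppr0.
have S0 : S (- - Rp) = 0 by rewrite opprK (calS_Rp hs).
have [Y_gt0 [C C0 YC] Yoo flux0] := sonic_approach RsRp e0 A0 h1 h2 h3 h4 h5 h6
  D0 S0 h7 Ya cY.
have Y_gt0' r : Rs < r < Rp -> 0 < Y r.
  by move=> rb; rewrite -[r]opprK; apply: Y_gt0; lra.
have Z_gt0 r : Rs < r < Rp -> 0 < Z r.
  move=> rb; have := Y_gt0' r rb; rewrite /Y pmulr_lgt0// invr_gt0 exprn_gt0//; lra.
have ZE r : Rs < r -> Z r = Y r * r ^+ 2.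
  by move=> rb; rewrite /Y divfK// expf_neq0// gt_eqF//; lra.
split=> //.
- exists (C * Rp) => [|r rb]; first by rewrite mulr_gt0.
  have rab : Rs < r < Rp by lra.
  have H : Z r <= (C * Rp * (Rp - r)) ^+ 2.
    rewrite ZE; last by lra.
    have r2 : r ^+ 2 <= Rp ^+ 2 by rewrite lerXn2r ?nnegrE//; lra.
    have -> : (C * Rp * (Rp - r)) ^+ 2 = (C * (Rp - r)) ^+ 2 * Rp ^+ 2 by ring.
    apply: ler_pM => //; [exact: ltW (Y_gt0' _ _)|exact: sqr_ge0|].
    have := YC (- r); rewrite !opprK [- r + _]addrC; apply; lra.
  apply: (le_trans (ler_wsqrtr H)); rewrite sqrtr_sqr ger0_norm//.
  by rewrite mulr_ge0 ?subr_ge0 ?mulr_ge0 ?(ltW C0) ?(ltW Rp0)//; lra.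
- move: Yoo; rewrite at_leftN -fmap_comp => Yoo.
  apply/cvgryPge => M; move/cvgryPge : Yoo => /(_ (M / Rs ^+ 2)) YM.
  near=> r.
  have rRm : Rs < r by near: r; apply: nbhs_right_gt.
  have rRs : r < Rp by near: r; apply: nbhs_right_lt; lra.
  have rb : Rs < r < Rp by rewrite rRm.
  have H1 : M <= Y r * Rs ^+ 2.
    rewrite -ler_pdivrMr ?exprn_gt0// -[r]opprK; near: r; exact: YM.
  apply: (le_trans H1); rewrite ZE// ler_wpM2l ?(ltW (Y_gt0' _ _))//.
  by rewrite lerXn2r ?nnegrE//; lra.
- apply/(cvg_at_rightNP (fun r => dS r ^+ 2 * (Z r / r ^+ 2)) Rs 0).
  by move: flux0; rewrite /comp; under eq_fun do rewrite sqrrN.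
Unshelve. all: by end_near. Qed.

End CanonicalSolutions.

(** * Joining the two branches at the sonic density *)

Section Branches.
Context {R : realType} (s : shock_data R) (Rs : R) (Zm Zp : R -> R).
Hypothesis hs : standing_setting s Rs.
Hypothesis hZm : canonical_minus s Rs Zm.
Hypothesis hZp : canonical_plus s Rs Zp.

Local Notation Rm := (Rm s).
Local Notation Rp := (Rp s).
Local Notation dS := (dcalS s).

(** At [Rs] this is [Zp Rs], which [canonical_plus] does not constrain. The facts below exclude that
    point or multiply the value by [dS Rs ^+ 2 = 0]. *)
Definition branch (r : R) : R := if r < Rs then Zm r else Zp r.
Local Notation Z := branch.
Local Notation dZ := (fun r => odeQ s r - odeP s r * Z r).

Lemma branch_gt0 (r : R) : Rm < r < Rp -> r != Rs -> 0 < Z r.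
Proof.
move=> rb rRs; rewrite /branch; case: (ltP r Rs) => [rRs'|Rsr].
  by have [+ _ _ _] := canonical_minusP hs hZm; apply; lra.
have [+ _ _ _] := canonical_plusP hs hZp; apply.
by rewrite lt_neqAle eq_sym rRs Rsr; lra.
Qed.

Lemma near_branch (r : R) : r != Rs ->
  \forall t \near r, Z t = if r < Rs then Zm t else Zp t.
Proof.
rewrite neq_lt => /orP[rRs|Rsr].
  rewrite rRs; have /near_in_itvNyo : r \in `]-oo, Rs[ by rewrite in_itv.
  by apply: filterS => t; rewrite in_itv/= /branch => ->.
rewrite ltNge (ltW Rsr)/=; have /near_in_itvoy : r \in `]Rs, +oo[.
  by rewrite in_itv/= Rsr.
by apply: filterS => t; rewrite in_itv/= andbT => Rst; rewrite /branch ltNge ltW.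
Qed.

Lemma is_derive_branch (r : R) : Rm < r < Rp -> r != Rs -> is_derive r 1 Z (dZ r).
Proof.
move=> rb rRs; have nZ := near_branch rRs.
have ZE := nbhs_singleton nZ.
have [[dm _] _ odem _] := hZm; have [[dp _] _ odep _] := hZp.
have nZ' : \forall t \near r, (if r < Rs then Zm t else Zp t) = Z t.
  by apply: filterS nZ => t ->.
apply: (near_eq_is_derive nZ') => /=; rewrite ZE.
case: (ltP r Rs) => [rRs'|Rsr].
  have rb' : Rm < r < Rs by lra.
  rewrite -(odem r rb') addrK derive1E; apply/derivableP.
  by apply: (dm 0%N r) => //; rewrite /= in_itv.
have rb' : Rs < r < Rp by rewrite lt_neqAle eq_sym rRs Rsr; lra.
rewrite -(odep r rb') addrK derive1E; apply/derivableP.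
by apply: (dp 0%N r) => //; rewrite /= in_itv.
Qed.

(** By the equation this expression coincides near [r] with [derive1] of the active branch, which is
    continuous as that branch is C^1. *)
Lemma continuous_dbranch (r : R) : Rm < r < Rp -> r != Rs ->
  {for r, continuous dZ}.
Proof.
move=> rb rRs; have nZ := near_branch rRs.
have [[_ cm] _ odem _] := hZm; have [[_ cp] _ odep _] := hZp.
have main (z : R -> R) (a b : R) : a < r < b ->
    (\forall t \near r, Z t = z t) ->
    (forall t, a < t < b -> derive1 z t + odeP s t * z t = odeQ s t) ->
    {for r, continuous (derive1 z)} -> {for r, continuous dZ}.
  move=> rab Zz ode cz.
  have nE : \forall t \near r, derive1 z t = dZ t.
    have : r \in `]a, b[ by rewrite in_itv.
    move=> /near_in_itvoo near_ab; near=> t.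
    rewrite (_ : Z t = z t); last by near: t.
    rewrite -(ode t) ?addrK//.
    have : t \in `]a, b[ by near: t.
    by rewrite in_itv.
  rewrite /prop_for /continuous_at -(nbhs_singleton nE).
  by apply: cvg_trans cz; apply: near_eq_cvg.
move: nZ; case: (ltP r Rs) => [rRs'|Rsr] nZ.
  apply: (main Zm Rm Rs) => //; first lra.
  by apply: (cm 1%N r) => //; rewrite /= in_itv/=; lra.
have Rsr' : Rs < r by rewrite lt_neqAle eq_sym rRs.
apply: (main Zp Rs Rp) => //; first lra.
by apply: (cp 1%N r) => //; rewrite /= in_itv/=; lra.
Unshelve. all: by end_near. Qed.

Lemma branch_flux_continuous : {for Rs, continuous (fun r => dS r ^+ 2 * (Z r / r ^+ 2))}.
Proof.
have [_ _ _ fm] := canonical_minusP hs hZm.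
have [_ _ _ fp] := canonical_plusP hs hZp.
apply/left_right_continuousP; rewrite (dcalS_Rs hs) expr0n mul0r; split.
- apply: cvg_trans fm; apply: near_eq_cvg; near=> r.
  by rewrite /branch ifT//; near: r; exact: nbhs_left_lt.
- apply: cvg_trans fp; apply: near_eq_cvg; near=> r.
  by rewrite /branch ltNge ltW//; near: r; exact: nbhs_right_gt.
Unshelve. all: by end_near. Qed.

Lemma sqrt_pinfty (T : Type) (F : set_system T) (f : T -> R) : Filter F ->
  f x @[x --> F] --> +oo -> Num.sqrt (f x) @[x --> F] --> +oo.
Proof.
move=> FF /cvgryPge foo; apply/cvgryPge => M.
apply: filterS (foo (M ^+ 2)) => x Mf.
apply: (le_trans (ler_norm M)); rewrite -sqrtr_sqr; exact: ler_wsqrtr.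
Qed.

Lemma profile_exists : exists u : R -> R,
  [/\ u 0 = Rs, continuous u, forall x, Rm < u x < Rp, {homo u : x y / x < y}
    & forall x : R, x != 0 -> is_derive x 1 u (Num.sqrt (Z (u x)))] /\
  (u x @[x --> -oo] --> Rm /\ u x @[x --> +oo] --> Rp).
Proof.
have RsB := Rs_between hs.
have [_ [C1 C10 H1] oo1 _] := canonical_minusP hs hZm.
have [_ [C2 C20 H2] oo2 _] := canonical_plusP hs hZp.
apply: (@singular_profile_exists R Rm Rp Rs ((Rm + Rs) / 2) ((Rs + Rp) / 2) (C1 + C2)
  (fun r => Num.sqrt (Z r))) => //.
- exact: addr_gt0.
- lra.
- lra.
- by move=> r rb rRs; rewrite sqrtr_gt0 branch_gt0.
- move=> r rb rRs; apply: continuous_comp; last exact: sqrt_continuous.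
  exact: is_derive_continuous (is_derive_branch rb rRs).
- apply: sqrt_pinfty; apply/cvgryPge => M.
  move/cvgryPge : oo1 => /(_ M); move/cvgryPge : oo2 => /(_ M).
  rewrite /at_left /at_right !near_withinE => n2 n1.
  near=> r => rRs.
  rewrite /branch; case: (ltP r Rs) => [rRs'|Rsr].
    by move: rRs'; near: r.
  have : Rs < r by rewrite lt_neqAle eq_sym Rsr andbT; exact/eqP/eqP.
  by near: r.
- move=> r rb; rewrite /branch ifT; last by lra.
  apply: (le_trans (H1 r _)); first lra.
  by rewrite ler_wpM2r ?subr_ge0 ?lerDl ?(ltW C20)//; lra.
- move=> r rb; rewrite /branch ifF; last by apply/negbTE; rewrite -leNgt; lra.
  apply: (le_trans (H2 r _)); first lra.
  by rewrite ler_wpM2r ?subr_ge0 ?lerDr ?(ltW C10)//; lra.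
Unshelve. all: by end_near. Qed.

End Branches.

(** Reduces integrability to intervals that do not have the crossing point 0 in their interior. *)
Lemma integrable_of_halves {R : realType} (f : R -> R) :
  (forall a b, a < b -> (b <= 0) || (0 <= a) ->
    (@lebesgue_measure R).-integrable `[a, b] (EFin \o f)) ->
  forall a b, (@lebesgue_measure R).-integrable `[a, b] (EFin \o f).
Proof.
move=> H a b; pose M := `|a| + `|b| + 1.
have := ler_norm (- a); have := ler_norm b; rewrite normrN => bM aM.
have := normr_ge0 a; have := normr_ge0 b => b0 a0.
have M0 : 0 < M by rewrite /M; lra.
apply: (@integrable_itv_cc _ f (- M) M); [by rewrite /M; lra|by rewrite /M; lra|].
apply: (@integrable_cat_cc _ f (- M) 0 M); [lra|lra| |].
  by apply: H; rewrite ?lexx//; lra.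
by apply: H; rewrite ?lexx ?orbT.
Qed.

Lemma is_derive_mul3 {R : realType} (k : R) (f g h : R -> R) (df dg dh x : R) :
  is_derive x 1 f df -> is_derive x 1 g dg -> is_derive x 1 h dh ->
  is_derive x 1 (fun y => k * (f y * g y * h y))
    (k * ((df * g x + f x * dg) * h x + f x * g x * dh)).
Proof.
by move=> dfx dgx dhx; apply: is_derive_eq; rewrite /GRing.scale/=; ring.
Qed.

(** * Regularity, limits and weak equation of the profile *)

Section ProfileProperties.
Context {R : realType} (s : shock_data R) (Rs : R) (Zm Zp : R -> R).
Hypothesis hs : standing_setting s Rs.
Hypothesis hZm : canonical_minus s Rs Zm.
Hypothesis hZp : canonical_plus s Rs Zp.

Local Notation alpha := (sd_alpha s).
Local Notation m := (sd_m s).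
Local Notation Rm := (Rm s).
Local Notation Rp := (Rp s).
Local Notation S := (calS s).
Local Notation dS := (dcalS s).
Local Notation ddp := (derive1n 2 (pressure s)).
Local Notation Z := (branch Rs Zm Zp).
Local Notation dZ := (fun r => odeQ s r - odeP s r * Z r).
Local Notation mu := (@lebesgue_measure R).

Variable u : R -> R.
Hypothesis u0 : u 0 = Rs.
Hypothesis cu : continuous u.
Hypothesis uB : forall x, Rm < u x < Rp.
Hypothesis u_lt : {homo u : x y / x < y}.
Hypothesis du : forall x : R, x != 0 -> is_derive x 1 u (Num.sqrt (Z (u x))).
Hypothesis uNy : u x @[x --> -oo] --> Rm.
Hypothesis uy : u x @[x --> +oo] --> Rp.

Let u_gt0 x : 0 < u x.
Proof. by have := uB x; have := Rm_gt0 hs; lra. Qed.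

Let u_neq (x : R) : x != 0 -> u x != Rs.
Proof.
by rewrite -u0 neq_lt => /orP[/u_lt ux|/u_lt ux]; [rewrite lt_eqF|rewrite gt_eqF].
Qed.

Lemma profile_derive1 (x : R) : x != 0 -> derive1 u x = Num.sqrt (Z (u x)).
Proof. by move=> /du[_ <-]; rewrite derive1E. Qed.

Lemma profile_derive1_sqr (x : R) : x != 0 -> derive1 u x ^+ 2 = Z (u x).
Proof.
by move=> x0; rewrite profile_derive1// sqr_sqrtr// ltW// (branch_gt0 hs hZm hZp)// u_neq.
Qed.

(** The factor [1 / (2 sqrt Z)] from the square root meets [u' = sqrt Z] from the chain rule, so
    only [Z'(u) / 2] remains. *)
Lemma is_derive_profile_derive1 (x : R) : x != 0 ->
  is_derive x 1 (derive1 u) (dZ (u x) / 2).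
Proof.
move=> x0; have nE : \forall y \near x, Num.sqrt (Z (u y)) = derive1 u y.
  by apply: filterS (near_neq x0) => y y0; rewrite profile_derive1.
apply: near_eq_is_derive nE _.
have Z0 : 0 < Z (u x) by apply: (branch_gt0 hs hZm hZp) => //; exact: u_neq.
have dZu := is_derive_branch hZm hZp (uB x) (u_neq x0).
have d1 := is_derive1_comp (is_derive1_sqrt Z0) dZu.
have := is_derive1_comp d1 (du x0).
suff -> : (2 * Num.sqrt (Z (u x)))^-1 * dZ (u x) * Num.sqrt (Z (u x)) = dZ (u x) / 2.
  by [].
have sZ : Num.sqrt (Z (u x)) != 0 by rewrite gt_eqF// sqrtr_gt0.
move: (Num.sqrt _) sZ => z z0; move: (dZ (u x)) => w; by field.
Qed.

Lemma profile_C2 : C_on 2 [set x | x != 0] u.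
Proof.
have c2 (x : R) : x != 0 -> {for x, continuous (derive1n 2 u)}.
  move=> x0.
  have nE : \forall y \near x, dZ (u y) / 2 = derive1n 2 u y.
    apply: filterS (near_neq x0) => y y0.
    by rewrite derive1nS derive1n1 derive1E; have [_ ->] := is_derive_profile_derive1 y0.
  have cdZ : dZ (u y) @[y --> x] --> dZ (u x).
    apply: (@continuous_comp _ _ _ u (fun r => dZ r)); first exact: cu.
    by apply: (continuous_dbranch hZm hZp) => //; exact: u_neq.
  have c2 : (dZ (u y) / 2) @[y --> x] --> dZ (u x) / 2.
    by apply: cvgM; [exact: cdZ|exact: cvg_cst].
  rewrite /prop_for /continuous_at -(nbhs_singleton nE).
  by apply: cvg_trans c2; apply: near_eq_cvg.
split=> [[|[|//]]|[|[|[|//]]]] x /=.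
- by move=> _ /du[].
- by move=> _ /is_derive_profile_derive1[].
- by move=> _ _; exact: cu.
- move=> _ x0; exact: (is_derive_continuous (is_derive_profile_derive1 x0)).
- by move=> _; exact: c2.
Qed.

Lemma profile_derive1_cvgNy : derive1 u x @[x --> -oo] --> 0.
Proof.
have RsB := Rs_between hs.
apply: (@cvg_trans _ (Num.sqrt (Zm (u x)) @[x --> -oo])).
  apply: near_eq_cvg; near=> x.
  have x0 : x < 0 by near: x; apply: nbhs_ninfty_lt; exact: num_real.
  rewrite profile_derive1 ?lt_eqF// /branch ifT//.
  by rewrite -u0 u_lt.
(* [Zm] has only a one-sided limit at [Rm]; the strict bound [Rm < u x] makes the approach
   one-sided. *)
have uR : u x @[x --> -oo] --> Rm^'+.
  move=> A nA; have uA : \forall x \near -oo, Rm < u x -> A (u x) := @uNy _ nA.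
  suff : \forall x \near -oo, A (u x) by [].
  by apply: filterS uA => x; apply; have /andP[] := uB x.
have Zu := @cvg_comp _ _ _ u Zm _ _ _ uR (canonical_minus_cvg hs hZm).
have := @cvg_comp _ _ _ _ Num.sqrt _ _ _ Zu (@sqrt_continuous R 0).
by rewrite sqrtr0.
Unshelve. all: by end_near. Qed.

Lemma profile_derive1_cvgy : derive1 u x @[x --> +oo] --> 0.
Proof.
have RsB := Rs_between hs.
apply: (@cvg_trans _ (Num.sqrt (Zp (u x)) @[x --> +oo])).
  apply: near_eq_cvg; near=> x.
  have x0 : 0 < x by near: x; apply: nbhs_pinfty_gt; exact: num_real.
  rewrite profile_derive1 ?gt_eqF// /branch ifF//.
  by apply/negbTE; rewrite -leNgt ltW// -u0 u_lt.
have uR : u x @[x --> +oo] --> Rp^'-.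
  move=> A nA; have uA : \forall x \near +oo, u x < Rp -> A (u x) := @uy _ nA.
  suff : \forall x \near +oo, A (u x) by [].
  by apply: filterS uA => x; apply; have /andP[] := uB x.
have Zu := @cvg_comp _ _ _ u Zp _ _ _ uR (canonical_plus_cvg hs hZp).
have := @cvg_comp _ _ _ _ Num.sqrt _ _ _ Zu (@sqrt_continuous R 0).
by rewrite sqrtr0.
Unshelve. all: by end_near. Qed.

(** At the crossing [derive1 u 0] is not controlled by [du], but the factor [dS Rs = 0] makes the
    flux vanish there. *)
Definition flux (x : R) : R := dS (u x) / u x * derive1 u x.

Definition dissipation (x : R) : R := 2 * alpha * (m ^+ 2 / u x ^+ 4) * derive1 u x ^+ 2.

Definition source (x : R) : R := S (u x) / u x - dissipation x.

Let flux_sqr x : flux x ^+ 2 = dS (u x) ^+ 2 * (Z (u x) / u x ^+ 2).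
Proof.
have [->|x0] := eqVneq x 0.
  by rewrite /flux u0 (dcalS_Rs hs) !mul0r !expr0n/= mul0r.
by rewrite /flux !exprMn profile_derive1_sqr// exprVn mulrAC mulrA.
Qed.

(** Insert [Z' = Q - P Z] in the product rule: the two parts of [P] cancel the [p''] of [S''] and
    the term from differentiating [1 / u]. The [Q] part gives [S / u], and the [- 2 m^2 / u^3] left
    in [S''] gives the dissipation. *)
Lemma is_derive_flux (x : R) : x != 0 ->
  is_derive x 1 (fun y => alpha * flux y) (source x).
Proof.
move=> x0; have ux := u_gt0 x; have ux0 : u x != 0 by rewrite gt_eqF.
have ddu := is_derive_profile_derive1 x0.
have dSu := is_derive1_comp (is_derive_dcalS hs ux) (du x0).
have dV := is_derive1_comp (is_derive_powV 0 ux0) (du x0).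
have := is_derive_mul3 alpha dSu dV ddu.
set l := (X in is_derive _ _ _ X -> _).
suff -> : l = source x by [].
rewrite {}/l /source /dissipation profile_derive1//= expr1.
rewrite /odeQ /odeP (derive1_calS hs)//.
have Z0 : 0 <= Z (u x) by rewrite ltW// (branch_gt0 hs hZm hZp)// u_neq.
have d0 := dcalS_neq0 hs ux (u_neq x0).
have alpha0 : alpha != 0 by rewrite gt_eqF// (alpha_gt0 hs).
have -> : derive1 (derive1 (pressure s)) (u x) = ddp (u x) by [].
have := sqr_sqrtr Z0; move: (Num.sqrt _) => z <-.
by field; rewrite ux0 d0 alpha0.
Qed.


Lemma flux_continuous : continuous (fun y => alpha * flux y).
Proof.
move=> x; have [->|x0] := eqVneq x 0; last first.
  exact: (is_derive_continuous (is_derive_flux x0)).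
have f0 : flux 0 = 0 by rewrite /flux u0 (dcalS_Rs hs) !mul0r.
rewrite /continuous_at f0; apply: cvgM; first exact: cvg_cst.
have cf2 : {for 0, continuous (fun y => flux y ^+ 2)}.
  rewrite (_ : (fun y => _) = fun y => dS (u y) ^+ 2 * (Z (u y) / u y ^+ 2)).
    apply: (@continuous_comp _ _ _ u (fun r => dS r ^+ 2 * (Z r / r ^+ 2))).
      exact: cu.
    by rewrite u0; exact: branch_flux_continuous hs hZm hZp.
  by apply/funext => y; exact: flux_sqr.
have cn : Num.sqrt (flux y ^+ 2) @[y --> 0] --> Num.sqrt (flux 0 ^+ 2).
  exact: (@continuous_comp _ _ _ (fun y => flux y ^+ 2) Num.sqrt 0 cf2
    (@sqrt_continuous R _)).
apply/norm_cvg0P; move: cn; rewrite f0 expr0n/= sqrtr0.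
by under eq_fun do rewrite sqrtr_sqr.
Qed.

Lemma continuous_calS_ratio : continuous (fun x => S (u x) / u x).
Proof.
move=> x; have ux := u_gt0 x.
apply: cvgM; last first.
  by apply: cvgV; [rewrite gt_eqF|exact: cu].
apply: (@continuous_comp _ _ _ u S); first exact: cu.
exact: is_derive_continuous (is_derive_calS hs ux).
Qed.

Lemma continuous_dissipation (x : R) : x != 0 -> {for x, continuous dissipation}.
Proof.
move=> x0; have ux := u_gt0 x.
have cu' := is_derive_continuous (is_derive_profile_derive1 x0).
apply: cvgM; last by apply: cvgM; exact: cu'.
apply: cvgM; first exact: cvg_cst.
apply: cvgM; first exact: cvg_cst.
apply: cvgV; first by rewrite expf_neq0// gt_eqF.
apply: (@continuous_comp _ _ _ u (fun r => r ^+ 4)); first exact: cu.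
exact: exprn_continuous.
Qed.

Lemma continuous_source (x : R) : x != 0 -> {for x, continuous source}.
Proof.
move=> x0; apply: cvgB; first exact: continuous_calS_ratio.
exact: continuous_dissipation.
Qed.

Lemma dissipation_ge0 x : 0 <= dissipation x.
Proof.
apply: mulr_ge0; last exact: sqr_ge0.
apply: mulr_ge0; first by rewrite mulr_ge0// ltW// (alpha_gt0 hs).
by apply: divr_ge0; [exact: sqr_ge0|rewrite exprn_ge0// ltW].
Qed.

(** With [T] a primitive of the continuous [S(u) / u], the function [T - alpha * flux] is continuous
    even at 0 and has the nonnegative derivative [dissipation] elsewhere. *)
Lemma integrable_dissipation (a b : R) : mu.-integrable `[a, b] (EFin \o dissipation).
Proof.
move: a b; apply: integrable_of_halves => a b ab ab0.
have x_neq0 x : a < x < b -> x != 0.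
  by move=> xab; apply/eqP => x0; move: ab0; rewrite x0 in xab; lra.
(* A larger open interval, so that [T] is differentiable, hence continuous, at [a] and [b] too. *)
have am : a - 1 < (a + b) / 2 < b + 1 by lra.
have [T dT] := antiderivative_oo am (fun x _ => @continuous_calS_ratio x).
apply: (@ge0_derive_integrable _ (fun x => T x - alpha * flux x) _ _ _ ab).
- move=> x; apply: cvgB.
    have : {within `[a, b], continuous T}.
      by apply: (is_derive_within_cc (dF := fun x => S (u x) / u x)) => y yab; apply: dT; lra.
    exact.
  exact: (continuous_subspaceT flux_continuous).
- move=> x xab; have dTx : is_derive x 1 T (S (u x) / u x) by apply: dT; lra.
  have dfx := is_derive_flux (x_neq0 x xab).
  by apply: is_derive_eq; rewrite /source opprB addrC subrK.
- by move=> x /x_neq0; exact: continuous_dissipation.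
- by move=> x _; exact: dissipation_ge0.
Qed.

Lemma integrable_source (a b : R) : mu.-integrable `[a, b] (EFin \o source).
Proof.
pose g x := S (u x) / u x.
have -> : EFin \o source = ((EFin \o g) \- (EFin \o dissipation))%E by [].
apply: integrableB => //; last exact: integrable_dissipation.
apply: continuous_compact_integrable; first exact: segment_compact.
exact: (continuous_subspaceT continuous_calS_ratio).
Qed.

Let continuous_derive1 (x : R) : x != 0 -> {for x, continuous (derive1 u)}.
Proof. by move=> x0; exact: is_derive_continuous (is_derive_profile_derive1 x0). Qed.

Lemma integrable_derive1_sqr (a b : R) :
  mu.-integrable `[a, b] (EFin \o (fun x => derive1 u x ^+ 2)).
Proof.
have a0 := alpha_gt0 hs.
have m2 : 0 < m ^+ 2 by rewrite exprn_even_gt0//= (m_neq0 hs).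
(* Since [u <= Rp], the weight in [dissipation] is at least [1 / K], so
   [u'^2 <= K * dissipation]. *)
pose K := Rp ^+ 4 / (2 * alpha * m ^+ 2).
have iK : mu.-integrable `[a, b] (fun x => (K%:E * (EFin \o dissipation) x)%E).
  by apply: integrableZl => //; exact: integrable_dissipation.
apply: (le_integrable _ _ _ iK) => //.
- apply/measurable_EFinP; apply: (@measurable_funS _ _ _ _ setT) => //.
  apply: (@measurable_fun_off_point _ _ 0) => x x0.
  by apply: cvgM; exact: continuous_derive1.
- move=> x _; have ux := u_gt0 x.
  have Rp0 : 0 < Rp by have := uB x; lra.
  have am : 0 < 2 * alpha * m ^+ 2 by rewrite mulr_gt0// mulr_gt0.
  have K0 : 0 <= K by apply: divr_ge0; [exact: exprn_ge0 (ltW Rp0)|exact: ltW].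
  have Kd : 0 <= K * dissipation x := mulr_ge0 K0 (dissipation_ge0 x).
  rewrite /= lee_fin ger0_norm ?sqr_ge0// ger0_norm//.
  have -> : K * dissipation x = (Rp ^+ 4 / u x ^+ 4) * derive1 u x ^+ 2.
    have alpha0 : alpha != 0 by rewrite gt_eqF.
    have u0' : u x != 0 by rewrite gt_eqF.
    by rewrite /K /dissipation; field; rewrite alpha0 u0' (m_neq0 hs).
  rewrite ler_peMl ?sqr_ge0// ler_pdivlMr ?exprn_gt0// mul1r.
  by rewrite lerXn2r ?nnegrE ?(ltW ux) ?(ltW Rp0)//; have := uB x; lra.
Qed.

Lemma integrable_derive1 (a b : R) : mu.-integrable `[a, b] (EFin \o derive1 u).
Proof.
move: a b; apply: integrable_of_halves => a b ab ab0.
have x_neq0 x : a < x < b -> x != 0.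
  by move=> xab; apply/eqP => x0; move: ab0; rewrite x0 in xab; lra.
apply: (@ge0_derive_integrable _ u _ _ _ ab).
- exact: (continuous_subspaceT cu).
- by move=> x /x_neq0 x0; rewrite profile_derive1//; exact: du.
- by move=> x /x_neq0; exact: continuous_derive1.
- by move=> x /x_neq0 x0; rewrite profile_derive1// sqrtr_ge0.
Qed.

Lemma profile_integral_identity : integral_identity s u (derive1 u).
Proof.
move=> phi tphi fl so.
have [i1 i2 E] := integration_by_parts_test flux_continuous is_derive_flux
  continuous_source integrable_source tphi.
have flE : fl = (fun x => alpha * flux x * derive1 phi x).
  apply/funext => x; rewrite /fl /flux (derive1_calS hs)//.
  by rewrite !mulrA.
have soE : so = (fun x => source x * phi x) by [].
by rewrite flE soE; split=> //; rewrite E addNr.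
Qed.

Lemma profile_W12loc : W12loc u (derive1 u).
Proof.
have mu' : measurable_fun setT (derive1 u).
  exact: (measurable_fun_off_point (x0 := 0)) continuous_derive1.
have cu2 : continuous (fun x => u x ^+ 2) by move=> x; apply: cvgM; exact: cu.
split.
- split; first exact: continuous_measurable_fun.
  apply: locally_integrable_of_cc; first exact: continuous_measurable_fun.
  move=> a b; apply: continuous_compact_integrable; first exact: segment_compact.
  exact: continuous_subspaceT.
- split; first exact: mu'.
  apply: locally_integrable_of_cc; last exact: integrable_derive1_sqr.
  apply: (@measurable_fun_off_point _ _ 0) => x x0.
  by apply: cvgM; exact: continuous_derive1.
- move=> phi tphi.
  have d (x : R) : x != 0 -> is_derive x 1 u (derive1 u x).
    by move=> x0; rewrite profile_derive1//; exact: du.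
  by have [_ _] := integration_by_parts_test cu d continuous_derive1 integrable_derive1 tphi.
Qed.

End ProfileProperties.

Theorem theorem4p5 (R : realType) (s : shock_data R) (Rs : R)
    (Zm Zp : R -> R)
    (hs : standing_setting s Rs)
    (hZm : canonical_minus s Rs Zm)
    (hZp : canonical_plus s Rs Zp) :
  exists (u : R -> R) (xis : R),
    [/\ continuous u, {homo u : x y / x < y} & forall x, Rm s < u x < Rp s] /\
    (u xis = Rs /\ C_on 2 [set x | x != xis] u) /\
    ((forall x, x < xis -> derive1 u x ^+ 2 = Zm (u x)) /\
     (forall x, xis < x -> derive1 u x ^+ 2 = Zp (u x))) /\
    [/\ u x @[x --> -oo] --> Rm s, u x @[x --> +oo] --> Rp s,
        derive1 u x @[x --> -oo] --> 0 & derive1 u x @[x --> +oo] --> 0] /\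
    integral_identity s u (derive1 u) /\
    profile_class s u.
Proof.
have [u [[u0 cu uB u_lt du] [uNy uy]]] := profile_exists hs hZm hZp.
have Ii := profile_integral_identity hs hZm hZp u0 cu uB u_lt du.
exists u, 0; do !split=> //.
- by apply: (profile_C2 hs hZm hZp u0 cu uB u_lt du).1.
- by apply: (profile_C2 hs hZm hZp u0 cu uB u_lt du).2.
- move=> x x0.
  rewrite (profile_derive1_sqr hs hZm hZp u0 uB u_lt du) ?lt_eqF//.
  by rewrite /branch ifT// -u0 u_lt.
- move=> x x0.
  rewrite (profile_derive1_sqr hs hZm hZp u0 uB u_lt du) ?gt_eqF//.
  by rewrite /branch ifF//; apply/negbTE; rewrite -leNgt ltW// -u0 u_lt.
- exact: (profile_derive1_cvgNy hs hZm u0 uB u_lt du uNy).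
- exact: (profile_derive1_cvgy hs hZp u0 uB u_lt du uy).
- by move=> x; have /andP[/ltW -> /ltW ->] := uB x.
- by move=> x y; rewrite le_eqVlt => /predU1P[->//|/u_lt/ltW].
- exists (derive1 u); last exact: Ii.
  exact: (profile_W12loc hs hZm hZp u0 cu uB u_lt du).
Qed.
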